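(* Let $N\ge 2$ be an integer and let $c(i,j)$, $1\le i<j\le N$, be real numbers. For $\beta\in\mathbb{R}$ let $$\mathcal{Z}(\beta)=\int_{(\mathbb{S}^2)^N}\prod_{1\le i<j\le N} d(p_i,p_j)^{2c(i,j)\beta}\,\mathrm{d}V^{\otimes N}\in[0,\infty].$$ Put $$T^+=-\min_S\frac{\sum_{i,j\in S:\,i<j}c(i,j)}{|S|-1},\qquad T^-=-\max_S\frac{\sum_{i,j\in S:\,i<j}c(i,j)}{|S|-1},$$ where $S$ ranges over all subsets of $\{1,\dots,N\}$ with $|S|\ge 2$. Then $\mathcal{Z}(\beta)$ is finite precisely for $\beta$ in the open interval $(\beta^-,\beta^+)$, where $$\beta^-=\begin{cases}1/T^- & \text{if } T^-<0,\\ -\infty&\text{otherwise,}\end{cases}\qquad \beta^+=\begin{cases}1/T^+ & \text{if } T^+>0,\\ \infty&\text{otherwise.}\end{cases}$$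
   Context: $\mathbb{S}^2$ is the unit sphere in $\mathbb{R}^3$, $d(\cdot,\cdot)$ is the chordal distance on $\mathbb{S}^2$ (Euclidean distance in $\mathbb{R}^3$), and $\mathrm{d}V$ is the rotation-invariant volume form on $\mathbb{S}^2$ normalized to be a probability measure; $\mathrm{d}V^{\otimes N}$ is the product measure on $(\mathbb{S}^2)^N$. *)

(* Defs.v *)
From HB Require Import structures.
From mathcomp Require Import all_boot all_order all_algebra.
From mathcomp Require Import all_classical all_reals all_analysis.

Set Implicit Arguments.
Unset Strict Implicit.
Unset Printing Implicit Defensive.

Import Order.TTheory GRing.Theory Num.Theory.
Import numFieldNormedType.Exports.

Local Open Scope classical_set_scope.
Local Open Scope ring_scope.

Section Sphere.
Variable R : realType.

Definition unit_vector (x : 'rV[R]_3) : bool := \sum_i x 0 i ^+ 2 == 1.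

Definition sphere : Type := {x : 'rV[R]_3 | unit_vector x}.

HB.instance Definition _ := Choice.on sphere.

Let pole_subproof : unit_vector (delta_mx 0 0).
Proof.
rewrite /unit_vector (bigD1 ord0) //= mxE !eqxx /= expr1n big1 ?addr0 // => i ni.
by rewrite mxE (negPf ni) andbF /= expr0n.
Qed.

HB.instance Definition _ :=
  isPointed.Build sphere (exist unit_vector _ pole_subproof).

Definition sphere_coord (i : 'I_3) (p : sphere) : R := val p 0 i.

(* The sigma-algebra generated by the three coordinate functions is the Borel
   sigma-algebra of the sphere, since 'rV[R]_3 is second countable. *)
Definition sphere_measurable : set (set sphere) :=
  g_sigma_preimage sphere_coord.

Let sphere_set0 : sphere_measurable set0.
Proof. exact: sigma_algebra0. Qed.

Let sphere_setC A : sphere_measurable A -> sphere_measurable (~` A).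
Proof. exact: sigma_algebraC. Qed.

Let sphere_bigcup (F : (set sphere)^nat) :
  (forall i, sphere_measurable (F i)) -> sphere_measurable (\bigcup_i F i).
Proof. exact: sigma_algebra_bigcup. Qed.

HB.instance Definition _ := @isMeasurable.Build default_measure_display
  sphere sphere_measurable sphere_set0 sphere_setC sphere_bigcup.

Definition chordal_dist (p q : sphere) : R :=
  Num.sqrt (\sum_i (val p 0 i - val q 0 i) ^+ 2).

Definition rotation (A : 'M[R]_3) : Prop := A *m A^T = 1%:M /\ \det A = 1.

Lemma rotate_subproof (A : 'M[R]_3) (p : sphere) :
  rotation A -> unit_vector (val p *m A).
Proof.
case: p => x hx [hA _]; apply/eqP; rewrite -[RHS](eqP hx) /=.
have sqE (y : 'rV[R]_3) : \sum_i y 0 i ^+ 2 = (y *m y^T) 0 0.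
  by rewrite mxE; apply: eq_bigr => i _; rewrite mxE expr2.
by rewrite !sqE trmx_mul mulmxA -(mulmxA _ A) hA mulmx1.
Qed.

Definition rotate (A : 'M[R]_3) (hA : rotation A) (p : sphere) : sphere :=
  exist unit_vector (val p *m A) (rotate_subproof p hA).

(* There is exactly one Borel probability measure on the sphere with this
   property: the normalized area measure. *)
Definition rotation_invariant (V : probability sphere R) : Prop :=
  forall (A : 'M[R]_3) (hA : rotation A) (B : set sphere),
    measurable B -> V (rotate hA @^-1` B) = V B.

End Sphere.

Section PowerMeasure.
Context {d : measure_display} {T : measurableType d} {R : realType}.

Definition tuple_cons n (x : T * n.-tuple T) : n.+1.-tuple T :=
  [tuple of x.1 :: x.2].

Lemma measurable_tuple_cons n : measurable_fun setT (@tuple_cons n).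
Proof. exact: measurable_cons. Qed.

HB.instance Definition _ n :=
  isMeasurableFun.Build _ _ _ _ (@tuple_cons n) (@measurable_tuple_cons n).

Fixpoint power_measure (P : probability T R) (n : nat) :
    probability (n.-tuple T) R :=
  match n with
  | 0 => \d_([tuple] : 0.-tuple T)
  | n'.+1 => distribution (P \x power_measure P n')%E (@tuple_cons n')
  end.

Lemma power_measure_box (P : probability T R) n (B : 'I_n -> set T) :
  (forall i, measurable (B i)) ->
  power_measure P n [set t | forall i, B i (tnth t i)] = (\prod_i P (B i))%E.
Proof.
elim: n B => [|n IH] B mB.
  rewrite big_ord0 /= diracE mem_set //=; by case.
rewrite big_ord_recl -IH; last by move=> i; exact: mB.
rewrite /= /distribution /= /pushforward /=.
rewrite -product_measure1E //; last first.
  rewrite (_ : mkset _ = \bigcap_(i : 'I_n)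
      ((fun t : n.-tuple T => tnth t i) @^-1` B (lift ord0 i))).
    apply: fin_bigcap_measurable; first exact: finite_finset.
    move=> i _; rewrite -[_ @^-1` _]setTI.
    by apply: measurable_tnth => //; exact: mB.
  by apply/seteqP; split=> t Ht i; [move=> _; exact: Ht | exact: (Ht i I)].
congr (_ _); apply/seteqP; split=> -[x t] /= Ht.
- split=> /=; first exact: (Ht ord0).
  by move=> i; have := Ht (lift ord0 i); rewrite tnthS.
- move=> i; case: (unliftP ord0 i) => [j|] ->.
    by rewrite tnthS; exact: Ht.2.
  exact: Ht.1.
Qed.

End PowerMeasure.

Section Partition.
Variables (R : realType) (N : nat) (c : 'I_N -> 'I_N -> R).

(* [0 `^ a] is [1] if [a = 0] and [0] otherwise, so for a negative exponent the
   integrand is not [+oo] when two points coincide; this only changes it on a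
   null set. *)
Definition partition_function (V : probability (sphere R) R) (beta : R) : \bar R :=
  (\int[power_measure V N]_p
    (\prod_(i < N) \prod_(j < N | (i < j)%N)
       chordal_dist (tnth p i) (tnth p j) `^ (2 * c i j * beta))%:E)%E.

Definition weight_ratio (S : {set 'I_N}) : R :=
  (\sum_(i in S) \sum_(j in S | (i < j)%N) c i j) / (#|S|%:R - 1).

(* The full set, whose ratio serves as the default value of the minimum and of
   the maximum, is itself in the range because [N >= 2]. *)
Definition Tp : R :=
  - \big[Order.min/weight_ratio [set: 'I_N]%SET]_(S : {set 'I_N} | (2 <= #|S|)%N)
      weight_ratio S.

Definition Tm : R :=
  - \big[Order.max/weight_ratio [set: 'I_N]%SET]_(S : {set 'I_N} | (2 <= #|S|)%N)
      weight_ratio S.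

Definition beta_minus : \bar R := if Tm < 0 then (Tm^-1)%:E else -oo%E.

Definition beta_plus : \bar R := if 0 < Tp then (Tp^-1)%:E else +oo%E.

End Partition.

(* Main.v *)
Require Import Defs.
From HB Require Import structures.
From mathcomp Require Import all_boot all_order all_algebra.
From mathcomp Require Import all_classical all_reals all_analysis.
From mathcomp Require Import measurable_realfun ring lra zify.

(* With a_ij = 2 beta c(i,j) and a(S) the sum of a_ij over pairs inside S, the
   claim is that the integral of the product of d_ij^a_ij is finite if and only
   if a(S) + 2(|S|-1) > 0 for all S with |S| >= 2. About V only the following is
   used: caps of radius r have measure between two positive multiples of r^2.
   By rotation invariance all caps of radius r have the same measure, so this
   follows by packing about r^-2 disjoint caps and by covering the sphere with
   about r^-2 caps.

   Finiteness. As there are finitely many S, some q < 2 has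
   a(S) + q(|S|-1) >= 0 for all of them. Splitting a configuration at its largest scale into two clusters whose mutual
   distances are all comparable to the diameter, and recursing into the
   clusters, bounds the integrand by a constant times the sum over spanning trees
   of the product of d_ij^-q over the edges. Each such product is integrated by
   removing the leaves one at a time, since the integral of d(x,y)^-q in x is
   bounded uniformly in y.

   Divergence. If a(S) + 2(|S|-1) <= 0, consider the configurations in which the
   points of S have mutual distances of order r and all other distances are of
   order 1. They have measure at least a multiple of r^(2(|S|-1)) and the
   integrand there is at least a multiple of r^a(S), so they contribute at least
   a constant independent of r; for a geometric sequence of scales r these sets
   are pairwise disjoint. *)

Set Implicit Arguments.
Unset Strict Implicit.
Unset Printing Implicit Defensive.

Import Order.TTheory GRing.Theory Num.Theory.
Import numFieldNormedType.Exports.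

Local Open Scope ring_scope.

(** * Pair products and tree sums *)

Lemma prod_powR (R : realType) (I : Type) (r : seq I) (P : pred I) (x : R) (F : I -> R) :
  0 < x -> \prod_(i <- r | P i) x `^ F i = x `^ (\sum_(i <- r | P i) F i).
Proof.
move=> x0; apply/esym.
apply: (big_morph (fun y => x `^ y)) => [y z|]; last by rewrite powRr0.
by rewrite powRD //; apply/implyP => _; rewrite gt_eqF.
Qed.

(** For [a >= 0] the left side is at most 1; for [a < 0] it is [t^-1] to the power [|a|], and
    [t^-1 <= x]. This treats factors of either sign of exponent alike. *)
Lemma powR_le_norm (R : realType) (x t a : R) : 0 < t -> t <= 1 -> 1 <= x * t ->
  t `^ a <= x `^ `|a|.
Proof.
move=> t0 t1 xt.
have x1 : 1 <= x.
  have x0 : 0 < x by rewrite -(pmulr_lgt0 _ t0); lra.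
  by apply: le_trans xt _; rewrite ger_pMr.
have [a0|a0] := lerP 0 a.
  apply: (@le_trans _ _ 1); last by rewrite -[leLHS](powRr0 x) ler_powR.
  by rewrite -[leRHS](powRr0 t) ger_powR ?t0.
rewrite -[a in t `^ a]opprK -mulN1r powRrM powR_inv1 ?(ltW t0) // ltr0_norm //.
apply: ge0_ler_powR; rewrite ?oppr_ge0 ?(ltW a0) // ?nnegrE ?invr_ge0 ?(ltW t0) //.
  exact: le_trans x1.
by rewrite -[t^-1]mul1r ler_pdivrMr.
Qed.

Section Pairs.
Variables (R : realType) (N : nat).
Implicit Types (S A B : {set 'I_N}) (h : 'I_N -> 'I_N -> R).

Definition pairs S : {set 'I_N * 'I_N} :=
  [set e | [&& e.1 \in S, e.2 \in S & (e.1 < e.2)%N]]%SET.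

Lemma pairsE S e : (e \in pairs S) = [&& e.1 \in S, e.2 \in S & (e.1 < e.2)%N].
Proof. by rewrite inE. Qed.

Lemma pairs_small S : (#|S| <= 1)%N -> pairs S = finset.set0.
Proof.
move=> /card_le1P S1; apply/setP => e; rewrite inE [RHS]inE.
apply/negbTE/negP => /and3P[e1 e2 e12].
have /= := S1 _ e1 e.2; rewrite e2 => /esym; rewrite inE => /eqP E.
by rewrite E ltnn in e12.
Qed.

Lemma sum_pairs (F : 'I_N -> 'I_N -> R) S :
  \sum_(i in S) \sum_(j in S | (i < j)%N) F i j = \sum_(e in pairs S) F e.1 e.2.
Proof. by rewrite pair_big_dep; apply: eq_bigl => e; rewrite pairsE. Qed.

Lemma prod_pairsT (F : 'I_N -> 'I_N -> R) :
  \prod_(i < N) \prod_(j < N | (i < j)%N) F i j =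
  \prod_(e in pairs [set: 'I_N]%SET) F e.1 e.2.
Proof.
by rewrite pair_big_dep; apply: eq_bigl => e; rewrite pairsE !finset.in_setT.
Qed.

Definition pair_weight (a : 'I_N -> 'I_N -> R) S : R := \sum_(e in pairs S) a e.1 e.2.

(* Expanding the recursion gives a sum over the ways to dismantle a spanning
   tree of [S] leaf by leaf of the product of [h] over the edges. *)
Fixpoint tree_sum h n S : R :=
  if n is n'.+1
  then \sum_(i in S) \sum_(j in S :\ i) tree_sum h n' (S :\ i)%SET * h i j
  else 1.

Lemma tree_sum_ge0 h n S : (forall i j, 0 <= h i j) -> 0 <= tree_sum h n S.
Proof.
move=> h0; elim: n S => [//|n IH] S /=.
by apply: sumr_ge0 => i _; apply: sumr_ge0 => j _; apply: mulr_ge0.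
Qed.

Lemma tree_sum_scale h k n S :
  tree_sum (fun i j => k * h i j) n S = k ^+ n * tree_sum h n S.
Proof.
elim: n S => [|n IH] S /=; first by rewrite expr0 mul1r.
rewrite mulr_sumr; apply: eq_bigr => i _; rewrite mulr_sumr; apply: eq_bigr => j _.
by rewrite IH exprS; ring.
Qed.

Lemma eq_tree_sum h h' n S : (forall i j, h i j = h' i j) ->
  tree_sum h n S = tree_sum h' n S.
Proof. by move=> hh; congr tree_sum; apply/funext => i; apply/funext. Qed.

(** Among the ways to dismantle the union, keep those that first remove leaves of [B] attached
    inside [B] until one vertex [b] is left, then remove [b] along an edge to a fixed [a] in [A], of
    weight at least 1, and finally dismantle [A]. The discarded terms are nonnegative. *)
Lemma tree_sum_merge h A B : (forall i j, 0 <= h i j) ->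
  (forall i j, i \in A :|: B -> j \in A :|: B -> i != j -> 1 <= h i j) ->
  A != finset.set0 -> B != finset.set0 -> [disjoint A & B] ->
  tree_sum h #|A|.-1 A * tree_sum h #|B|.-1 B <= tree_sum h (#|A| + #|B|).-1 (A :|: B).
Proof.
move=> h0 + A0; have [m] := ubnP #|B|; elim: m B => [//|m IH] B ltBm h1 B0 dAB.
have [a aA] : exists a, a \in A by apply/set0Pn.
have Apos : (0 < #|A|)%N by rewrite card_gt0.
have Bpos : (0 < #|B|)%N by rewrite card_gt0.
have BnA i : i \in B -> i \notin A by move=> iB; rewrite (disjointFl dAB).
have AUD i : i \in B -> ((A :|: B) :\ i = A :|: B :\ i)%SET.
  move=> iB; rewrite finset.setDUl; congr (_ :|: _)%SET; apply/finset.setDidPl.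
  by rewrite disjoint_sym disjoints1 BnA.
have [B1|B1] := leqP #|B| 1.
  have /eqP/cards1P[b Bb] : #|B| = 1%N by lia.
  rewrite Bb cards1 /= mulr1 addn1 /=.
  rewrite -[X in tree_sum _ X (A :|: _)%SET](prednK Apos) /=.
  have bAB : b \in (A :|: [set b])%SET by rewrite !inE eqxx orbT.
  have bB : b \in B by rewrite Bb !inE.
  have abAB : a \in ((A :|: [set b]) :\ b)%SET.
    by rewrite !inE aA andbT; apply: contraNneq (BnA _ bB) => <-.
  rewrite (bigD1 b) //= (bigD1 a) //= -addrA.
  have -> : ((A :|: [set b]) :\ b)%SET = A.
    by have := AUD _ bB; rewrite Bb finset.setDv finset.setU0.
  apply: (@le_trans _ _ (tree_sum h #|A|.-1 A * h b a)).
    rewrite ler_peMr ?tree_sum_ge0 //; apply: h1; rewrite ?inE ?aA ?eqxx ?orbT //.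
      by rewrite bB orbT.
    by apply: contraNneq (BnA _ bB) => ->.
  rewrite lerDl addr_ge0 //; apply: sumr_ge0 => *; last apply: sumr_ge0 => *.
    by rewrite mulr_ge0 ?tree_sum_ge0.
  by rewrite mulr_ge0 ?tree_sum_ge0.
have [k Bk] : exists k, #|B| = k.+2 by exists #|B|.-2; lia.
rewrite Bk addnS /=.
have hg0 i j S n : 0 <= tree_sum h n S * h i j by rewrite mulr_ge0 ?tree_sum_ge0.
rewrite mulr_sumr addnS /= [leRHS](bigID (mem B)) /=.
apply: ler_wpDr; first by do 2 (apply: sumr_ge0 => ? _).
rewrite [leRHS](eq_bigl (mem B)); last first.
  by move=> i; rewrite !inE andbC; case: (i \in B); rewrite //= orbT.
apply: ler_sum => i iB; rewrite mulr_sumr [leRHS](bigID (mem B)) /=.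
apply: ler_wpDr; first by apply: sumr_ge0.
rewrite [leRHS](eq_bigl (mem (B :\ i)%SET)); last first.
  by move=> j; rewrite !inE; case: (j \in B); rewrite ?orbT ?andbT ?andbF.
have cBi : #|(B :\ i)%SET| = k.+1 by move: Bk; rewrite (cardsD1 i B) iB => -[].
apply: ler_sum => j jB; rewrite mulrA ler_wpM2r // AUD //.
have /IH : (#|(B :\ i)%SET| < m)%N by lia.
rewrite cBi addnS; apply.
- move=> u v; rewrite -AUD // => /setD1P[_ ?] /setD1P[_ ?] ?; exact: h1.
- by apply/set0Pn; exists j.
- by apply: disjointWr dAB; apply: subD1set.
Qed.

(** [C] is the set of cross pairs. Pairs are ordered by index, so the first entry of a cross pair
    may lie in either part. *)
Lemma pairsU A B : [disjoint A & B] ->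
  exists C : {set 'I_N * 'I_N},
    (forall F : 'I_N * 'I_N -> R, \prod_(e in pairs (A :|: B)) F e =
      \prod_(e in pairs A) F e * \prod_(e in pairs B) F e * \prod_(e in C) F e) /\
    (forall e, e \in C -> (e.1 \in A) && (e.2 \in B) || (e.1 \in B) && (e.2 \in A)).
Proof.
move=> dAB; exists (pairs (A :|: B) :\: (pairs A :|: pairs B))%SET; split.
  move=> F; rewrite -bigU /=; last first.
    rewrite -setI_eq0; apply/eqP/setP => e; rewrite !inE.
    apply/negbTE/negP => /andP[/and3P[eA _ _] /and3P[eB _ _]].
    by rewrite (disjointFr dAB eA) in eB.
  rewrite (big_setID (pairs A :|: pairs B)%SET) /=; congr (_ * _).
  apply: eq_bigl => e; rewrite !inE.
  by case: (e.1 \in A); case: (e.1 \in B); case: (e.2 \in A); case: (e.2 \in B);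
    case: (_ < _)%N.
move=> e; rewrite !inE.
by case: (e.1 \in A); case: (e.1 \in B); case: (e.2 \in A); case: (e.2 \in B);
  case: (_ < _)%N.
Qed.

(** * Bounding the pair product by a tree sum in a finite metric space *)

Section Metric.
Variables (d : 'I_N -> 'I_N -> R).
Hypothesis (dxx : forall i, d i i = 0) (dsym : forall i j, d i j = d j i).
Hypothesis (dtri : forall i j k, d i k <= d i j + d j k).
Hypothesis (dpos : forall i j, i != j -> 0 < d i j).

(* Single linkage: [A] is the cluster of [x] in the graph joining points at
   distance less than [d x y / N]. *)
Lemma cluster_split S x y : x \in S -> y \in S -> x != y ->
  exists A, [/\ x \in A, y \notin A, A \subset S &
    forall i j, i \in A -> j \in S -> j \notin A -> d x y <= N%:R * d i j].
Proof.
move=> xS yS xy.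
pose e := [rel i j | (j \in S) && (N%:R * d i j < d x y)].
have pathS p i : i \in S -> path e i p -> last i p \in S.
  elim: p i => [//|j p IH] i iS /= /andP[/andP[jS _] ?]; exact: IH.
have pathd p i : path e i p -> N%:R * d i (last i p) <= (size p)%:R * d x y.
  elim: p i => [|j p IH] i /=; first by rewrite dxx mulr0 mul0r.
  move=> /andP[/andP[_ ij] /IH jp].
  rewrite -natr1 mulrDl mul1r addrC.
  apply: le_trans (lerD (ltW ij) jp); rewrite -mulrDr.
  by rewrite ler_wpM2l ?ler0n.
exists [set i | connect e x i]%SET; split.
- by rewrite inE connect0.
- rewrite inE; apply/negP => /connectP[p ep yl].
  (* If [y] were in the cluster, a path to it without repeated vertices would have at least [N]
     edges by [pathd], hence more than [N] vertices. *)
  have := ep; have := yl; case/shortenP: (ep) => p' ep' up' _ yl' _ .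
  have := pathd _ _ ep'; rewrite -yl' ler_pM2r ?dpos // ler_nat leqNgt.
  apply/negP; rewrite negbK.
  by have := card_uniqP up'; move=> /= <-; rewrite -[X in (_ <= X)%N]card_ord; exact: max_card.
- by apply/fintype.subsetP => i; rewrite inE => /connectP[p ep ->]; apply: pathS.
- move=> i j; rewrite !inE => xi jS xj; rewrite leNgt; apply: contra xj => ij.
  by apply: connect_trans xi (connect1 _); rewrite /= jS.
Qed.

Variables (a : 'I_N -> 'I_N -> R) (q : R).
Hypothesis q0 : 0 <= q.
Hypothesis hyp : forall S, (1 < #|S|)%N -> 0 <= pair_weight a S + q * #|S|.-1%:R.

(** Bounds the product over the cross pairs of a split; the sum runs over all ordered pairs, so that
    one constant serves every split of the recursion. *)
Let L : R := N%:R `^ (\sum_(e : 'I_N * 'I_N) `|a e.1 e.2|).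

(** Strong induction on [#|S|]. Here [D] may exceed the diameter, so that the induction hypothesis
    applies to both clusters at the diameter of [S]. Each split costs one factor [L] and adds one
    tree edge. *)
Lemma prod_dist_le S D : S != finset.set0 -> 0 < D ->
  (forall i j, i \in S -> j \in S -> d i j <= D) ->
  \prod_(e in pairs S) (d e.1 e.2 / D) `^ a e.1 e.2 <=
  L ^+ #|S|.-1 * tree_sum (fun i j => (d i j / D) `^ (- q)) #|S|.-1 S.
Proof.
have d0 i j : 0 <= d i j.
  by have [->|/dpos/ltW//] := eqVneq i j; rewrite dxx.
have [m] := ubnP #|S|; elim: m S D => [//|m IH] S D ltSm S0 D0 dD.
have N1 : (1 : R) <= N%:R.
  rewrite ler1n; have /set0Pn[i _] := S0; exact: leq_ltn_trans (ltn_ord i).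
have L1 : 1 <= L by rewrite /L -[leLHS](powRr0 N%:R) ler_powR // sumr_ge0.
have L0 : 0 <= L by apply: le_trans L1.
have [S1|S1] := leqP #|S| 1.
  have -> : #|S| = 1%N by have := S0; rewrite -card_gt0; lia.
  by rewrite pairs_small // big_set0 /= mulr1.
have [x [y [xS yS xy dmax]]] : exists x y, [/\ x \in S, y \in S, x != y &
    forall i j, i \in S -> j \in S -> d i j <= d x y].
  have /card_gt1P[x0 [y0 [xS yS xy]]] := S1.
  pose P (e : 'I_N * 'I_N) := (e.1 \in S) && (e.2 \in S).
  have P0 : P (x0, y0) by rewrite /P /= xS.
  case: (arg_maxP (fun e : 'I_N * 'I_N => d e.1 e.2) P0) => -[x y] /= /andP[/= xS' yS'] dm.
  have dm' i j : i \in S -> j \in S -> d i j <= d x y.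
    by move=> iS jS; apply: (dm (i, j)); rewrite /P /= iS.
  exists x, y; split => //; apply: contraTneq (dm' _ _ xS yS) => ->.
  by rewrite dxx -ltNge dpos.
have D'0 := dpos xy; set D' := d x y in dmax D'0.
have D'D : D' <= D by apply: dD.
(* By [hyp] at [S], rescaling from the diameter [D'] up to [D] only helps. *)
suff H : \prod_(e in pairs S) (d e.1 e.2 / D') `^ a e.1 e.2 <=
    L ^+ #|S|.-1 * tree_sum (fun i j => (d i j / D') `^ (- q)) #|S|.-1 S.
  have dE i j : d i j / D = (D' / D) * (d i j / D') by field; lra.
  have rho0 : 0 < D' / D by apply: divr_gt0.
  under eq_bigr do rewrite dE powRM ?(ltW rho0) ?divr_ge0 ?(ltW D'0) //.
  rewrite big_split /= prod_powR // -/(pair_weight a S).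
  rewrite (@eq_tree_sum _ (fun i j => (D' / D) `^ (- q) * (d i j / D') `^ (- q))); last first.
    by move=> i j; rewrite dE powRM ?(ltW rho0) ?divr_ge0 ?(ltW D'0).
  rewrite tree_sum_scale mulrCA.
  apply: ler_pM => //; first exact: powR_ge0.
    by apply: prodr_ge0 => e _; apply: powR_ge0.
  rewrite -powR_mulrn ?powR_ge0 // -powRrM.
  apply: ger_powR; first by rewrite rho0 ler_pdivrMr // mul1r.
  by have := hyp S1; rewrite mulNr; lra.
have [A [xA yA sAS AB]] := cluster_split xS yS xy.
pose B := (S :\: A)%SET.
have yB : y \in B by rewrite inE yA.
have SE : S = (A :|: B)%SET.
  by apply/setP => i; rewrite !inE; case: (boolP (i \in A)) => //= /(fintype.subsetP sAS) ->.
have dAB : [disjoint A & B] by apply/pred0P => i /=; rewrite !inE; case: (i \in A).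
have A0 : A != finset.set0 by apply/set0Pn; exists x.
have B0 : B != finset.set0 by apply/set0Pn; exists y.
have cS : #|S| = (#|A| + #|B|)%N by rewrite SE cardsU (disjoint_setI0 dAB) cards0 subn0.
have Apos : (0 < #|A|)%N by rewrite card_gt0.
have Bpos : (0 < #|B|)%N by rewrite card_gt0.
have AS i : i \in A -> i \in S by rewrite SE inE => ->.
have BS i : i \in B -> i \in S by case/finset.setDP.
have BnA i : i \in B -> i \notin A by case/finset.setDP.
have h0 i j : 0 <= (d i j / D') `^ (- q) by apply: powR_ge0.
have [ltA ltB] : (#|A| < m)%N /\ (#|B| < m)%N by clear -ltSm cS Apos Bpos; lia.
have IHA := IH A D' ltA A0 D'0 (fun i j iA jA => dmax i j (AS i iA) (AS j jA)).
have IHB := IH B D' ltB B0 D'0 (fun i j iA jA => dmax i j (BS i iA) (BS j jA)).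
have [C [CE CAB]] := pairsU dAB.
have -> : pairs S = pairs (A :|: B) by rewrite -SE.
rewrite CE cS.
have -> : (#|A| + #|B|).-1 = (#|A|.-1 + #|B|.-1 + 1)%N by clear -Apos Bpos; lia.
rewrite !exprD expr1.
(* For a cross pair [d / D'] lies between [1 / N] and 1, so its factor is at most [N] to the power
   [|a|]. *)
have cross : \prod_(e in C) (d e.1 e.2 / D') `^ a e.1 e.2 <= L.
  apply: (@le_trans _ _ (\prod_(e in C) N%:R `^ `|a e.1 e.2|)).
    apply: ler_prod => e /CAB eAB; rewrite powR_ge0 /=.
    have [e1 e2 De] : [/\ e.1 \in S, e.2 \in S & D' <= N%:R * d e.1 e.2].
      case/orP: eAB => /andP[e1 e2].
        by split; [exact: AS|exact: BS|apply: AB => //; [exact: BS|exact: BnA]].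
      split; [exact: BS|exact: AS|rewrite dsym].
      by apply: AB => //; [exact: BS|exact: BnA].
    have de0 : 0 < d e.1 e.2.
      by rewrite -(pmulr_rgt0 _ (lt_le_trans ltr01 N1)); apply: lt_le_trans De.
    apply: powR_le_norm; first exact: divr_gt0.
      by rewrite ler_pdivrMr // mul1r dmax.
    by rewrite mulrA ler_pdivlMr // mul1r.
  rewrite prod_powR ?(lt_le_trans _ N1) // /L ler_powR //.
  rewrite [leRHS](bigID (mem C)) /= lerDl; exact: sumr_ge0.
have P0 (E : {set 'I_N * 'I_N}) : 0 <= \prod_(e in E) (d e.1 e.2 / D') `^ a e.1 e.2.
  by apply: prodr_ge0 => e _; apply: powR_ge0.
apply: le_trans (ler_pM _ _ (ler_pM _ _ IHA IHB) cross) _; rewrite ?mulr_ge0 //.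
rewrite -mulrA [leLHS](_ : _ = L ^+ #|A|.-1 * L ^+ #|B|.-1 * L *
  (tree_sum (fun i j => (d i j / D') `^ (- q)) #|A|.-1 A *
   tree_sum (fun i j => (d i j / D') `^ (- q)) #|B|.-1 B)); last by ring.
apply: ler_wpM2l; first by rewrite !mulr_ge0 ?exprn_ge0.
rewrite SE (_ : _ + 1 = (#|A| + #|B|).-1)%N; last by clear -Apos Bpos; lia.
(* All distances in [S] are at most [D'] and the exponent [- q] is nonpositive, so the edge joining
   the two trees has weight at least 1. *)
apply: tree_sum_merge => // i j; rewrite -SE => iS jS ij.
rewrite -[leLHS](powRr0 (d i j / D')); apply: ger_powR; last by rewrite oppr_le0.
by rewrite divr_gt0 ?dpos // ler_pdivrMr // mul1r dmax.
Qed.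
End Metric.
End Pairs.

(** * Integration over product measures *)

Section Resample.
Context {d : measure_display} {T : measurableType d} {R : realType}.
Variable P : probability T R.
Local Open Scope ereal_scope.

Lemma integral_prob_cst (Q : probability T R) (k : \bar R) : \int[Q]_x k = k.
Proof. by rewrite integral_cst // [X in _ * X]probability_setT mule1. Qed.

Definition tuple_upd n (t : n.-tuple T) (i : 'I_n) (x : T) : n.-tuple T :=
  [tuple if j == i then x else tnth t j | j < n].

Lemma tnth_upd n (t : n.-tuple T) i x j :
  tnth (tuple_upd t i x) j = if j == i then x else tnth t j.
Proof. by rewrite tnth_mktuple. Qed.

Lemma measurable_tuple_upd n (i : 'I_n) :
  measurable_fun setT (fun xt : T * n.-tuple T => tuple_upd xt.2 i xt.1).
Proof.
apply/measurable_fun_tnthP => j; rewrite /comp.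
under eq_fun do rewrite tnth_upd.
case: (j == i); first exact: measurable_fst.
by apply: (measurableT_comp (measurable_tnth j)); exact: measurable_snd.
Qed.

Lemma ge0_integral_power_measureS n (f : n.+1.-tuple T -> \bar R) :
  measurable_fun [set: n.+1.-tuple T] f -> (forall p, 0 <= f p) ->
  \int[power_measure P n.+1]_p f p =
  \int[P]_x \int[power_measure P n]_t f (tuple_cons (x, t)).
Proof.
move=> mf f0; rewrite /= ge0_integral_distribution //.
rewrite fubini_tonelli1 //=.
by apply: measurableT_comp => //; exact: measurable_tuple_cons.
Qed.

(** The coordinates are independent, so replacing one by a fresh sample does not change the law. The
    induction peels off the head coordinate. *)
Lemma integral_resample n (i : 'I_n) (f : n.-tuple T -> \bar R) :
  measurable_fun [set: n.-tuple T] f -> (forall p, 0 <= f p) ->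
  \int[power_measure P n]_p f p =
  \int[power_measure P n]_p \int[P]_x f (tuple_upd p i x).
Proof.
elim: n i f => [[]//|n IH] i f mf f0.
have mfu : measurable_fun setT (fun xt : T * n.+1.-tuple T => f (tuple_upd xt.2 i xt.1)).
  by apply: measurableT_comp => //; exact: measurable_tuple_upd.
have mI : measurable_fun [set: n.+1.-tuple T]
    (fun p : n.+1.-tuple T => \int[P]_x f (tuple_upd p i x)).
  exact: (@measurable_fun_fubini_tonelli_G _ _ _ _ _ P _ mfu).
rewrite ge0_integral_power_measureS // ge0_integral_power_measureS //; last first.
  by move=> p; apply: integral_ge0.
have mfc : measurable_fun setT (fun xt : T * n.-tuple T => f (tuple_cons xt)).
  by apply: measurableT_comp => //; exact: measurable_tuple_cons.
case: (unliftP ord0 i) => [j|] ->{mfu mI i}.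
  apply: eq_integral => x _.
  rewrite (IH j) //; last exact: measurableT_comp mfc (pair1_measurable _).
  apply: eq_integral => t _; apply: eq_integral => y _; congr f.
  apply: eq_from_tnth => k; rewrite !tnth_upd.
  case: (unliftP ord0 k) => [l|] ->; rewrite ?tnthS ?tnth0 ?(inj_eq lift_inj) ?tnth_upd //.
(* Resampling the head forgets its old value, so the outer integral on the right is that of a
   constant; what remains is an exchange of the order of integration. *)
have E : forall (x y : T) (t : n.-tuple T),
    tuple_upd (tuple_cons (x, t)) ord0 y = tuple_cons (y, t).
  move=> x y t; apply: eq_from_tnth => k; rewrite !tnth_upd.
  by case: (unliftP ord0 k) => [l|] ->; rewrite ?tnthS ?tnth0.
under [RHS]eq_integral => x _ do under eq_integral => t _ do under eq_integral => y _ do rewrite E.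
rewrite integral_prob_cst.
by apply: (@fubini_tonelli _ _ _ _ _ P (power_measure P n) (fun xt => f (tuple_cons xt)) mfc) => xt.
Qed.
End Resample.

Lemma measurable_sum_cond (d : measure_display) (T : measurableType d) (R : realType)
    (I : Type) (r : seq I) (Q : pred I) (h : I -> T -> R) :
  (forall i, Q i -> measurable_fun setT (h i)) ->
  measurable_fun setT (fun x => \sum_(i <- r | Q i) h i x).
Proof.
move=> mh; under eq_fun do rewrite big_mkcond.
apply: measurable_sum => i; case: (boolP (Q i)) => [/mh//|_].
exact: measurable_cst.
Qed.

Lemma measurable_prod_cond (d : measure_display) (T : measurableType d) (R : realType)
    (I : eqType) (r : seq I) (Q : pred I) (h : I -> T -> R) :
  (forall i, Q i -> measurable_fun setT (h i)) ->
  measurable_fun setT (fun x => \prod_(i <- r | Q i) h i x).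
Proof.
move=> mh; under eq_fun do rewrite big_mkcond.
apply: measurable_prod => i _; case: (boolP (Q i)) => [/mh//|_].
exact: measurable_cst.
Qed.

Lemma integral_sum_lty (d : measure_display) (T : measurableType d) (R : realType)
    (mu : {measure set T -> \bar R}) (I : Type) (r : seq I) (Q : pred I) (h : I -> T -> R) :
  (forall i x, Q i -> 0 <= h i x) ->
  (forall i, Q i -> measurable_fun setT (h i)) ->
  (forall i, Q i -> (\int[mu]_x (h i x)%:E < +oo)%E) ->
  (\int[mu]_x (\sum_(i <- r | Q i) h i x)%:E < +oo)%E.
Proof.
move=> h0 mh hoo; elim: r => [|i r IH].
  by under eq_integral => x _ do rewrite big_nil; rewrite integral0 ltry.
case Qi : (Q i); last by under eq_integral => x _ do rewrite big_cons Qi.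
under eq_integral => x _ do rewrite big_cons Qi EFinD.
rewrite ge0_integralD //.
- by rewrite lte_add_pinfty // hoo.
- by move=> x _; rewrite lee_fin h0.
- exact/measurable_EFinP/mh.
- by move=> x _; rewrite lee_fin; apply: sumr_ge0 => j; apply: h0.
- exact/measurable_EFinP/measurable_sum_cond.
Qed.

(** * Integrability of tree sums *)

Section TreeIntegral.
Context {d : measure_display} {T : measurableType d} {R : realType}.
Variables (P : probability T R) (N : nat) (k : T -> T -> R) (M : R).
Hypothesis k0 : forall x y, 0 <= k x y.
Hypothesis mk : measurable_fun setT (fun xy : T * T => k xy.1 xy.2).
Hypothesis kM : forall y, (\int[P]_x (k x y)%:E <= M%:E)%E.

Let h (p : N.-tuple T) i j := k (tnth p i) (tnth p j).

Let mh i j : measurable_fun setT (fun p => h p i j).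
Proof.
rewrite (_ : (fun p => h p i j) =
  (fun xy => k xy.1 xy.2) \o (fun p => (tnth p i, tnth p j))) //.
apply: measurableT_comp => //.
by apply: measurable_fun_pair; exact: measurable_tnth.
Qed.

Lemma measurable_tree_sum n (S : {set 'I_N}) : measurable_fun setT
  (fun p : N.-tuple T => tree_sum (fun i j => k (tnth p i) (tnth p j)) n S).
Proof.
change (measurable_fun setT (fun p => tree_sum (h p) n S)).
elim: n S => [|n IH] S /=; first exact: measurable_cst.
apply: measurable_sum_cond => i _; apply: measurable_sum_cond => j _.
exact: measurable_funM.
Qed.

Let tree_upd n (S : {set 'I_N}) p i x : i \notin S ->
  tree_sum (h (tuple_upd p i x)) n S = tree_sum (h p) n S.
Proof.
elim: n S => [//|n IH] S iS /=.
apply: eq_bigr => u uS; apply: eq_bigr => v; rewrite !inE => /andP[vu vS].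
rewrite IH; last by rewrite !inE negb_and iS orbT.
by rewrite /h !tnth_upd !ifF //; apply: contraNF iS => /eqP <-.
Qed.

(** In each summand the removed leaf [i] occurs only in the edge factor [h p i j]. Resampling [i]
    and integrating it out first costs at most a factor [M] and leaves a tree sum with one edge
    fewer. *)
Lemma integral_tree_sum_lty n (S : {set 'I_N}) :
  (\int[power_measure P N]_p
    (tree_sum (fun i j => k (tnth p i) (tnth p j)) n S)%:E < +oo)%E.
Proof.
change (\int[power_measure P N]_p (tree_sum (h p) n S)%:E < +oo)%E.
have mtree : forall n S, measurable_fun setT (fun p => tree_sum (h p) n S) := measurable_tree_sum.
have h0 p i j : 0 <= h p i j by exact: k0.
have t0 p m U : 0 <= tree_sum (h p) m U by apply: tree_sum_ge0 => i j; apply: k0.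
elim: n S => [|n IH] S /=.
  by rewrite integral_prob_cst ltry.
apply: integral_sum_lty => [i p _|i _|i iS].
- by apply: sumr_ge0 => j _; rewrite mulr_ge0.
- by apply: measurable_sum_cond => j _; apply: measurable_funM.
apply: integral_sum_lty => [j p _|j _|j].
- by rewrite mulr_ge0.
- exact: measurable_funM.
rewrite !inE => /andP[ji jS].
have mf : measurable_fun setT (fun p => tree_sum (h p) n (S :\ i)%SET * h p i j).
  exact: measurable_funM.
rewrite (integral_resample P i); last 2 first.
- exact/measurable_EFinP.
- by move=> p; rewrite lee_fin mulr_ge0.
have tE p x : tree_sum (h (tuple_upd p i x)) n (S :\ i)%SET * h (tuple_upd p i x) i j =
    tree_sum (h p) n (S :\ i)%SET * k x (tnth p j).
  by rewrite tree_upd /h ?tnth_upd ?eqxx ?(negbTE ji) // finset.setD11.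
under eq_integral => p _ do under eq_integral => x _ do rewrite tE EFinM.
have mkj y : measurable_fun setT (fun x => k x y).
  rewrite (_ : (fun x => k x y) = (fun xy => k xy.1 xy.2) \o (fun x => (x, y))) //.
  by apply: measurableT_comp => //; exact: pair2_measurable.
have M0 : 0 <= M.
  by rewrite -lee_fin; apply: le_trans (kM point); apply: integral_ge0 => x _; rewrite lee_fin.
have IE p : (\int[P]_x ((tree_sum (h p) n (S :\ i)%SET)%:E * (k x (tnth p j))%:E) =
    (tree_sum (h p) n (S :\ i)%SET)%:E * \int[P]_x (k x (tnth p j))%:E)%E.
  rewrite ge0_integralZl //.
  - exact/measurable_EFinP.
  - by move=> x _; rewrite lee_fin.
  - by rewrite lee_fin.
under eq_integral => p _ do rewrite IE.
apply: (@le_lt_trans _ _ (\int[power_measure P N]_p (M%:E * (tree_sum (h p) n (S :\ i)%SET)%:E))%E).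
  apply: ge0_le_integral => //.
  - by move=> p _; rewrite mule_ge0 ?lee_fin //; apply: integral_ge0 => x _; rewrite lee_fin.
  - have mI : measurable_fun setT (fun y => \int[P]_x (k x y)%:E)%E.
      by apply: (@measurable_fun_fubini_tonelli_G _ _ _ _ _ P
        (fun xy => (k xy.1 xy.2)%:E)) => [|xy]; [exact/measurable_EFinP|rewrite lee_fin].
    apply: emeasurable_funM; first exact/measurable_EFinP.
    rewrite (_ : (fun p : N.-tuple T => _) =
      (fun y => \int[P]_x (k x y)%:E)%E \o (fun p => tnth p j)) //.
    by apply: measurableT_comp => //; exact: measurable_tnth.
  - by apply: measurable_funeM; exact/measurable_EFinP.
  by move=> p _; rewrite muleC lee_wpmul2r // lee_fin.
rewrite ge0_integralZl // ?lte_mul_pinfty //.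
- exact/measurable_EFinP.
- by move=> p _; rewrite lee_fin.
Qed.
End TreeIntegral.

(** * Finiteness on 2-regular spaces *)

Definition dball (T : Type) (R : realType) (dist : T -> T -> R) (x : T) (r : R) : set T :=
  [set y | dist y x < r]%classic.

Section Sufficiency.
Local Open Scope classical_set_scope.
Context {d : measure_display} {T : measurableType d} {R : realType}.
Variables (P : probability T R) (dist : T -> T -> R) (C : R).
Hypothesis mdist : measurable_fun setT (fun xy : T * T => dist xy.1 xy.2).
Hypothesis dist_ge0 : forall x y, 0 <= dist x y.
Hypothesis distxx : forall x, dist x x = 0.
Hypothesis dist_sym : forall x y, dist x y = dist y x.
Hypothesis dist_tri : forall x y z, dist x z <= dist x y + dist y z.
Hypothesis dist_le2 : forall x y, dist x y <= 2.
Hypothesis ball_le : forall x (r : R), 0 < r -> (P (dball dist x r) <= (C * r ^+ 2)%:E)%E.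

Lemma ball_cst_ge0 : 0 <= C.
Proof.
by rewrite -[C]mulr1 -(expr1n R 2) -lee_fin; apply: le_trans (ball_le point ltr01).
Qed.

Lemma measurable_dist_tnth N i j :
  measurable_fun setT (fun p : N.-tuple T => dist (tnth p i) (tnth p j)).
Proof.
rewrite (_ : (fun p : N.-tuple T => _) =
  (fun xy => dist xy.1 xy.2) \o (fun p => (tnth p i, tnth p j))) //.
apply: measurableT_comp => //.
by apply: measurable_fun_pair; exact: measurable_tnth.
Qed.

Lemma measurable_distl y : measurable_fun setT (fun x => dist x y).
Proof.
rewrite (_ : (fun x => _) = (fun xy => dist xy.1 xy.2) \o (fun x => (x, y))) //.
by apply: measurableT_comp => //; exact: pair2_measurable.
Qed.

Lemma measurable_dball x (r : R) : measurable (dball dist x r).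
Proof.
have -> : dball dist x r = (fun y => dist y x < r) @^-1` [set true].
  by apply/seteqP; split => y.
rewrite -[_ @^-1` _]setTI; apply: measurable_fun_ltr => //.
exact: measurable_distl.
Qed.

(** Take the least [n] satisfying the first inequality. The factor 4 instead of 2 accommodates
    [n = 0], where [t] may equal 2. *)
Lemma dyadic_scale (t : R) : 0 < t -> t <= 2 ->
  exists n : nat, 2^-1 ^+ n <= t /\ t < 4 * 2^-1 ^+ n.
Proof.
move=> t0 t2.
have ex : exists n : nat, 2^-1 ^+ n <= t.
  exists (Num.truncn t^-1).+1; rewrite exprVn invf_ple ?posrE ?exprn_gt0 //.
  apply: ltW; apply: lt_le_trans (truncnS_gt _) _.
  by rewrite -natrX ler_nat ltnW // ltn_expl.
case: (ex_minnP ex) => n nt nmin; exists n; split => //.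
case: n nt nmin => [_ _|n _ nmin]; first by rewrite expr0; lra.
have := nmin n; rewrite ltnn => /contraFN; rewrite -ltNge exprS.
by move=> /(_ erefl); lra.
Qed.

(** Where [dist x y] is of order [2^-n] the integrand is at most [2^(q n)], and this region lies in
    a ball of measure at most [16 C 4^-n]. The bounds sum as a geometric series of ratio
    [2^(q - 2) < 1]. *)
Lemma riesz_bound (q : R) : 0 <= q -> q < 2 ->
  exists M : R, forall y, (\int[P]_x (dist x y `^ (- q))%:E <= M%:E)%E.
Proof.
move=> q0 q2.
pose rho : R := 2 `^ (q - 2).
have rho0 : 0 < rho by apply: powR_gt0.
have rho1 : rho < 1.
  rewrite -[ltRHS](powRr0 2) /rho /powR pnatr_eq0 /= ltr_expR mul0r.
  by rewrite pmulr_llt0 ?ln_gt0 // ?ltr1n // subr_lt0.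
exists (C * 16 / (1 - rho)) => y.
pose B n := dball dist y (4 * 2^-1 ^+ n).
pose F n (x : T) := ((2 `^ (q * n%:R))%:E * (\1_(B n) x)%:E)%E.
have F0 n x : (0 <= F n x)%E by rewrite /F -EFinM lee_fin mulr_ge0 ?powR_ge0.
have mF n : measurable_fun setT (F n).
  by apply: measurable_funeM; apply/measurable_EFinP/measurable_indic/measurable_dball.
apply: (@le_trans _ _ (\int[P]_x (\sum_(n <oo) F n x))%E).
  apply: ge0_le_integral => //.
  - by move=> x _; rewrite lee_fin powR_ge0.
  - apply/measurable_EFinP; apply: measurableT_comp (measurable_powR _) _.
    exact: measurable_distl.
  - by apply: ge0_emeasurable_sum => // n x _.
  move=> x _.
  have FE n : dist x y `^ (- q) <= 2 `^ (q * n%:R) -> dist x y < 4 * 2^-1 ^+ n ->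
      ((dist x y `^ (- q))%:E <= \sum_(n <oo) F n x)%E.
    move=> h1 h2; apply: (@le_trans _ _ (F n x)).
      by rewrite /F indicE mem_set // mule1 lee_fin.
    rewrite (@nneseriesD1 _ (F^~ x) n xpredT) // leeDl //; exact: nneseries_ge0.
  (* At distance 0 the power is 0, or 1 if [q = 0], so the term [n = 0] of the series, which is 1
     there, suffices. *)
  have [d0|d0] := eqVneq (dist x y) 0.
    apply: (FE 0%N); rewrite d0 ?mulr0 ?powRr0 ?expr0; last by lra.
    have [->|q00] := eqVneq q 0; first by rewrite oppr0 powRr0.
    by rewrite powR0 // oppr_eq0.
  have dpos : 0 < dist x y by rewrite lt_def d0 dist_ge0.
  have [n [n1 n2]] := dyadic_scale dpos (dist_le2 _ _).
  apply: (FE n) n2.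
  have -> : (2 : R) `^ (q * n%:R) = (2^-1 ^+ n) `^ (- q).
    by rewrite -powR_mulrn ?invr_ge0 // -[in RHS]powR_inv1 // -!powRrM; congr powR; ring.
  rewrite !powRN lef_pV2 ?posrE ?powR_gt0 ?exprn_gt0 //.
  by apply: ge0_ler_powR; rewrite ?nnegrE ?exprn_ge0 ?invr_ge0.
rewrite integral_nneseries //.
apply: (@le_trans _ _ (\sum_(n <oo) (C * 16 * rho ^+ n)%:E)%E).
  apply: lee_nneseries => [n _ _|n _]; first exact: integral_ge0.
  rewrite ge0_integralZl //; last first.
    by apply/measurable_EFinP/measurable_indic/measurable_dball.
  rewrite integral_indic ?setIT //; last exact: measurable_dball.
  apply: (@le_trans _ _ ((2 `^ (q * n%:R))%:E * (C * (4 * 2^-1 ^+ n) ^+ 2)%:E)%E).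
    rewrite lee_wpmul2l ?lee_fin ?powR_ge0 //; apply: ball_le.
    by rewrite mulr_gt0 // exprn_gt0.
  rewrite -EFinM lee_fin -[rho ^+ n]powR_mulrn ?powR_ge0 // -powRrM mulrBl powRD; last first.
    by apply/implyP => _; rewrite pnatr_eq0.
  have -> : (2 : R) `^ (- (2 * n%:R)) = (2^-1 ^+ n) ^+ 2.
    by rewrite powRN powRrM powR_mulrn ?powR_ge0 // powR_mulrn // exprAC !exprVn.
  by rewrite le_eqVlt; apply/orP; left; apply/eqP; ring.
have u0 n : (0 <= n)%N -> true -> (0 <= (C * 16 * rho ^+ n)%:E)%E.
  by move=> _ _; rewrite lee_fin !mulr_ge0 ?exprn_ge0 ?(ltW rho0) ?ball_cst_ge0.
apply: (lime_le (is_cvg_nneseries u0)); apply: nearW => n; rewrite sumEFin lee_fin.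
apply: le_trans (geometric_le_lim n _ rho0 _).
- by rewrite le_eqVlt; apply/orP; left; apply/eqP.
- by rewrite mulr_ge0 ?ball_cst_ge0.
- by rewrite gtr0_norm.
Qed.

Lemma measurable_coincidence N (i j : 'I_N) :
  measurable [set p : N.-tuple T | dist (tnth p i) (tnth p j) = 0%R].
Proof.
rewrite (_ : [set p | _] =
  (fun p : N.-tuple T => dist (tnth p i) (tnth p j)) @^-1` [set 0]) //.
by rewrite -[_ @^-1` _]setTI; exact: measurable_dist_tnth.
Qed.

(** After resampling point [i], the set to be measured lies in every ball around point [j], and the
    measure of these balls tends to 0 with the radius. *)
Lemma coincidence_null N (i j : 'I_N) : i != j ->
  (power_measure P N [set p | dist (tnth p i) (tnth p j) = 0%R] = 0)%E.
Proof.
move=> ij; set Z := [set p | _].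
have mZ : measurable Z by exact: measurable_coincidence.
rewrite -(setIT Z) -integral_indic // (integral_resample P i); last 2 first.
- exact/measurable_EFinP/measurable_indic.
- by move=> p; rewrite lee_fin.
rewrite integral0_eq // => p _.
have mZ0 : measurable [set x | dist x (tnth p j) = 0%R].
  rewrite (_ : [set x | _] = (fun x => dist x (tnth p j)) @^-1` [set 0]) //.
  rewrite -[_ @^-1` _]setTI; exact: measurable_distl.
under eq_integral => x _.
  rewrite (_ : \1_Z _ = \1_[set x | dist x (tnth p j) = 0] x); first over.
  rewrite !indicE /Z; congr (_ _)%:R; apply/asbool_equiv_eq.
  by rewrite /= !tnth_upd eqxx eq_sym (negbTE ij).
rewrite integral_indic // setIT.
apply/eqP; rewrite -measure_le0; apply/lee_addgt0Pr => e e0; rewrite add0e.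
have C0 := ball_cst_ge0.
(* With [r <= 1] one has [C r^2 <= C r <= e]; the denominator is [C + 1] because [C] may be 0. *)
pose r := Num.min 1 (e / (C + 1)).
have r0 : 0 < r by rewrite lt_min ltr01 divr_gt0 //; lra.
have r1 : r <= 1 by rewrite ge_min lexx.
have re : r * (C + 1) <= e by rewrite -ler_pdivlMr ?ge_min ?lexx ?orbT //; lra.
apply: (@le_trans _ _ (P (dball dist (tnth p j) r))).
  apply: le_measure; rewrite ?inE //; first exact: measurable_dball.
  by move=> x /= xj; rewrite /dball /= xj.
by apply: le_trans (ball_le _ r0) _; rewrite lee_fin; nra.
Qed.

Lemma integral_prod_dist_lty N (a : 'I_N -> 'I_N -> R) : (0 < N)%N ->
  (forall S : {set 'I_N}, (1 < #|S|)%N -> 0 < pair_weight a S + 2 * #|S|.-1%:R) ->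
  (\int[power_measure P N]_p
    (\prod_(e in pairs [set: 'I_N]%SET)
      dist (tnth p e.1) (tnth p e.2) `^ a e.1 e.2)%:E < +oo)%E.
Proof.
move=> N0 ha.
(* The smallest admissible [q] is a maximum over finitely many [S], and the strict inequalities [ha]
   keep it below 2. *)
have [q [q0 q2 hq]] : exists q : R, [/\ 0 <= q, q < 2 &
    forall S : {set 'I_N}, (1 < #|S|)%N -> 0 <= pair_weight a S + q * #|S|.-1%:R].
  pose f (S : {set 'I_N}) : R := - pair_weight a S / #|S|.-1%:R.
  exists (\big[Num.max/0]_(S : {set 'I_N} | (1 < #|S|)%N) f S); split.
  - exact: bigmax_ge_id.
  - apply/bigmax_ltP; split => // S S1; rewrite /f ltr_pdivrMr ?ltr0n; last by lia.
    by have := ha S S1; lra.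
  move=> S S1; rewrite -[X in X + _]opprK addrC subr_ge0 -ler_pdivrMr ?ltr0n; last by lia.
  exact: (le_bigmax_cond _ f).
have [M hM] := riesz_bound q0 q2.
(* Distances are divided by their bound 2, so that [prod_dist_le] applies with [D = 2]; the power of
   2 in [K] undoes this in the integrand. *)
pose k x y := (dist x y / 2) `^ (- q).
have mk : measurable_fun setT (fun xy : T * T => k xy.1 xy.2).
  apply: measurableT_comp (measurable_powR _) _; exact: measurable_funM.
have kM y : (\int[P]_x (k x y)%:E <= ((2^-1) `^ (- q) * M)%:E)%E.
  under eq_integral => x _.
    rewrite /k powRM ?invr_ge0 // EFinM muleC; over.
  rewrite ge0_integralZl //.
  - by rewrite EFinM lee_wpmul2l // lee_fin powR_ge0.
  - apply/measurable_EFinP; apply: measurableT_comp (measurable_powR _) _.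
    exact: measurable_distl.
  - by move=> x _; rewrite lee_fin powR_ge0.
have k0 x y : 0 <= k x y by apply: powR_ge0.
pose L : R := N%:R `^ (\sum_(e : 'I_N * 'I_N) `|a e.1 e.2|).
pose K : R := 2 `^ pair_weight a [set: 'I_N]%SET * L ^+ N.-1.
have K0 : 0 <= K by rewrite mulr_ge0 ?exprn_ge0 ?powR_ge0.
pose tr (p : N.-tuple T) := tree_sum (fun i j => k (tnth p i) (tnth p j)) N.-1 [set: 'I_N]%SET.
have tr0 p : 0 <= tr p by apply: tree_sum_ge0.
have troo : (\int[power_measure P N]_p (tr p)%:E < +oo)%E.
  exact: integral_tree_sum_lty mk kM _ _.
have mtr : measurable_fun setT tr by exact: measurable_tree_sum mk _ _.
apply: (@le_lt_trans _ _ (\int[power_measure P N]_p (K%:E * (tr p)%:E))%E); last first.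
  rewrite ge0_integralZl // ?lte_mul_pinfty //.
  - exact/measurable_EFinP.
  - by move=> p _; rewrite lee_fin.
(* The pointwise bound requires positive distances between distinct indices, hence holds only off
   the null coincidence sets. *)
apply: ae_ge0_le_integral => //.
- by move=> p _; rewrite lee_fin prodr_ge0 // => e _; apply: powR_ge0.
- apply/measurable_EFinP; apply: measurable_prod_cond => e _.
  apply: measurableT_comp (measurable_powR _) _; exact: measurable_dist_tnth.
- by move=> p _; rewrite mule_ge0 ?lee_fin.
- by apply: measurable_funeM; apply/measurable_EFinP.
have aeZ (e : 'I_N * 'I_N) : {ae power_measure P N, forall p,
    e.1 != e.2 -> dist (tnth p e.1) (tnth p e.2) != 0}.
  have [->|ne] := eqVneq e.1 e.2; first exact: aeW.
  exists [set p | dist (tnth p e.1) (tnth p e.2) = 0%R]; split.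
  - exact: measurable_coincidence.
  - exact: coincidence_null.
  by move=> p /= /not_implyP[_ /negP]; rewrite negbK => /eqP.
have aeZ' : {ae power_measure P N, forall p, forall e : 'I_N * 'I_N,
    e.1 != e.2 -> dist (tnth p e.1) (tnth p e.2) != 0} by exact: filter_forall.
apply: filterS aeZ' => p hp _.
rewrite -EFinM lee_fin.
pose dd i j := dist (tnth p i) (tnth p j).
have dpos i j : i != j -> 0 < dd i j.
  by move=> ij; rewrite lt_def dist_ge0 andbT; apply: (hp (i, j)).
have cN : #|[set: 'I_N]%SET| = N by rewrite cardsT card_ord.
have T0 : [set: 'I_N]%SET != finset.set0 by rewrite -card_gt0 cN.
have := prod_dist_le (fun i => distxx _) (fun i j => dist_sym _ _)
  (fun i j l => dist_tri _ _ _) dpos q0 hq T0 (ltr0n _ 2) (fun i j _ _ => dist_le2 _ _).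
rewrite cN => /(ler_wpM2l (powR_ge0 2 (pair_weight a [set: 'I_N]%SET))).
rewrite mulrA; apply: le_trans.
rewrite /pair_weight -prod_powR // -big_split /= ler_prod // => e _.
rewrite powR_ge0 /= -powRM ?divr_ge0 ?dist_ge0 //.
by rewrite mulrCA mulfV // mulr1.
Qed.

End Sufficiency.

(** * Divergence on 2-regular spaces *)

Lemma measurable_forall (d : measure_display) (T : measurableType d) (I : finType)
    (b : I -> T -> bool) :
  (forall i, measurable_fun setT (b i)) ->
  measurable_fun setT (fun x => [forall i, b i x]).
Proof.
move=> mb.
have -> : (fun x => [forall i, b i x]) = (fun x => \big[andb/true]_i b i x).
  by apply/funext => x; rewrite big_andE; apply: eq_forallb.
elim: (index_enum I) => [|i s IH].
  by under eq_fun do rewrite big_nil; exact: measurable_cst.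
under eq_fun do rewrite big_cons.
exact: measurable_and.
Qed.

Lemma measurable_natr_bool (d : measure_display) (T : measurableType d) (R : realType)
    (b : T -> bool) :
  measurable_fun setT b -> measurable_fun setT (fun x => (b x)%:R : R).
Proof.
move=> mb; rewrite (_ : (fun x => _) = (fun c : bool => c%:R : R) \o b) //.
exact: measurableT_comp.
Qed.

Lemma measure_bigsetU_le (d : measure_display) (T : measurableType d) (R : realType)
    (mu : {measure set T -> \bar R}) (I : Type) (s : seq I) (A : I -> set T) :
  (forall i, measurable (A i)) ->
  (mu (\big[setU/set0]_(i <- s) A i) <= \sum_(i <- s) mu (A i))%E.
Proof.
move=> mA; elim: s => [|i s IH]; first by rewrite !big_nil measure0.
rewrite !big_cons; apply: (@le_trans _ _ (mu (A i) + mu (\big[setU/set0]_(j <- s) A j))%E).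
  by apply: measureU2 => //; apply: bigsetU_measurable.
exact: leeD2l.
Qed.

Section Necessity.
Local Open Scope classical_set_scope.
Context {d : measure_display} {T : measurableType d} {R : realType}.
Variables (P : probability T R) (dist : T -> T -> R) (C c : R).
Hypothesis mdist : measurable_fun setT (fun xy : T * T => dist xy.1 xy.2).
Hypothesis dist_sym : forall x y, dist x y = dist y x.
Hypothesis dist_tri : forall x y z, dist x z <= dist x y + dist y z.
Hypothesis dist_le2 : forall x y, dist x y <= 2.
Hypothesis ball_le : forall x (r : R), 0 < r -> (P (dball dist x r) <= (C * r ^+ 2)%:E)%E.
Hypothesis ball_ge : forall x (r : R), 0 < r -> r <= 1 ->
  ((c * r ^+ 2)%:E <= P (dball dist x r))%E.
Hypothesis c0 : 0 < c.

Variables (N : nat) (S : {set 'I_N}) (i0 : 'I_N).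
Hypothesis i0S : i0 \in S.
Hypothesis i0min : forall i, i \in S -> (i0 <= i)%N.

Let mball x r : measurable (dball dist x r) := measurable_dball mdist x r.

(** Union bound: removing [N] balls of radius [s] costs at most [N C s^2]. This provides room for a
    new point away from the others. *)
Lemma measure_diff_balls (A : set T) (y : N.-tuple T) (s m : R) : measurable A -> 0 < s ->
  ((m + N%:R * (C * s ^+ 2))%:E <= P A)%E ->
  (m%:E <= P (A `\` \big[setU/set0]_(j < N) dball dist (tnth y j) s))%E.
Proof.
move=> mA s0; set U := \big[setU/set0]_(j < N) _.
have mU : measurable U by apply: bigsetU_measurable => j _; exact: mball.
have PU : (P U <= (N%:R * (C * s ^+ 2))%:E)%E.
  apply: (@le_trans _ _ (\sum_(j < N) P (dball dist (tnth y j) s))%E).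
    by apply: measure_bigsetU_le => j; exact: mball.
  apply: (@le_trans _ _ (\sum_(j < N) (C * s ^+ 2)%:E)%E).
    by apply: lee_sum => j _; exact: ball_le.
  by rewrite sumEFin sumr_const card_ord mulr_natl.
move=> h; rewrite -(leeD2rE (x := (N%:R * (C * s ^+ 2))%:E)) // -EFinD.
apply: (le_trans h); apply: (@le_trans _ _ (P (A `\` U) + P U)%E); last by rewrite leeD2l.
apply: le_trans (measureU2 _ _ _) => //; last exact: measurableD.
apply: le_measure; rewrite ?inE //; first by apply: measurableU => //; exact: measurableD.
by move=> x Ax; have [Ux|Ux] := pselect (U x); [right|left].
Qed.

(** By [hK], [N] balls of radius [r / K] take at most half of the lower bound [c r^2] for a ball of
    radius [r]; by [hrho], [N] balls of radius [rho] take at most half of the whole space. *)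
Variables (K rho : R).
Hypothesis (K1 : (1 : R) <= K) (hK : N%:R * C <= c / 2 * K ^+ 2).
Hypothesis (rho0 : 0 < rho) (rho1 : rho <= (1 : R)) (hrho : N%:R * (C * rho ^+ 2) <= (1 : R) / 2).

(* The points of [S] lie at scale [r] around the point [i0 = min S], every other
   point (and [i0] itself) is [rho]-separated from the preceding ones. *)
Definition placed (r : R) (i : 'I_N) (p : N.-tuple T) : bool :=
  if (i \in S) && (i != i0) then
    (dist (tnth p i) (tnth p i0) < r) &&
    [forall j : 'I_N, (j \in S) && (j < i)%N ==> (r / K <= dist (tnth p i) (tnth p j))]
  else [forall j : 'I_N, (j < i)%N ==> (rho <= dist (tnth p i) (tnth p j))].

Definition placed_upto r m p : R := \prod_(i < N | (i < m)%N) (placed r i p)%:R.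

Lemma measurable_placed r i : measurable_fun setT (placed r i).
Proof.
have md := @measurable_dist_tnth _ _ _ _ mdist N.
rewrite /placed; case: ((i \in S) && (i != i0)).
  apply: measurable_and; first exact: measurable_fun_ltr.
  apply: measurable_forall => j; case: (_ && _) => /=; last exact: measurable_cst.
  exact: measurable_fun_ler.
apply: measurable_forall => j; case: (_ < _)%N => /=; last exact: measurable_cst.
exact: measurable_fun_ler.
Qed.

Lemma measurable_placed_upto r m : measurable_fun setT (placed_upto r m).
Proof.
apply: measurable_prod_cond => i _; apply: measurable_natr_bool.
exact: measurable_placed.
Qed.

Lemma placed_upto_ge0 r m p : 0 <= placed_upto r m p.
Proof. by apply: prodr_ge0. Qed.

(** The condition on point [i] involves only points of index at most [i]. For [i] in [S] this uses
    that the centre [i0] is the least element of [S]. *)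
Lemma placed_upd r (i k : 'I_N) x p : (i < k)%N -> placed r i (tuple_upd p k x) = placed r i p.
Proof.
move=> ik; have ne (j : 'I_N) : (j <= i)%N -> (j == k) = false.
  by move=> ji; apply/negbTE; rewrite -val_eqE /=; lia.
rewrite /placed; case: ifP => [/andP[iS ii0]|_].
  congr (_ && _); first by rewrite !tnth_upd !ne ?i0min.
  apply: eq_forallb => j; case: (boolP (_ && _)) => //= /andP[jS ji].
  by rewrite !tnth_upd !ne // ltnW.
apply: eq_forallb => j; case: (boolP (_ < _)%N) => //= ji.
by rewrite !tnth_upd !ne // ltnW.
Qed.

Lemma measurable_placed_upd r k p :
  measurable_fun setT (fun x => (placed r k (tuple_upd p k x))%:R : R).
Proof.
apply: measurable_natr_bool.
rewrite (_ : (fun x => _) = placed r k \o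
  (fun xt : T * N.-tuple T => tuple_upd xt.2 k xt.1) \o (fun x => (x, p))) //.
apply: measurableT_comp; last exact: pair2_measurable.
by apply: measurableT_comp; [exact: measurable_placed|exact: measurable_tuple_upd].
Qed.

(** A lower bound for the conditional probability of placing point [i] correctly, given the others.
    The factor one half is what remains after removing the forbidden balls. *)
Let mass r (i : 'I_N) : R := if (i \in S) && (i != i0) then c / 2 * r ^+ 2 else 1 / 2.

Lemma placed_mass r k p : 0 < r -> r <= 1 ->
  ((mass r k)%:E <= \int[P]_x ((placed r k (tuple_upd p k x))%:R)%:E)%E.
Proof.
move=> r0 r1.
have K0 : 0 < K by apply: lt_le_trans K1.
have mW := measurable_placed_upd r k p.
(* Both kinds of point are treated at once: [A] is the region allowed for the new point and [s] the
   distance it keeps from the points of [p]. *)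
suff [A [s [mA s0 mle Wle]]] : exists A s, [/\ measurable A, 0 < s,
    ((mass r k + N%:R * (C * s ^+ 2))%:E <= P A)%E &
    forall x, A x -> (forall j, s <= dist x (tnth p j)) -> placed r k (tuple_upd p k x)].
  apply: le_trans (measure_diff_balls p mA s0 mle) _.
  set U := \big[setU/set0]_(j < N) _.
  have mU : measurable U by apply: bigsetU_measurable => j _; exact: mball.
  rewrite -[X in P X]setIT -integral_indic //; last exact: measurableD.
  apply: ge0_le_integral => //.
  - by apply/measurable_EFinP/measurable_indic; exact: measurableD.
  - exact/measurable_EFinP.
  move=> x _; rewrite lee_fin indicE.
  case: (boolP (x \in A `\` U)) => //; rewrite inE => -[Ax Ux].
  rewrite Wle // => j; rewrite leNgt; apply/negP => xj; apply: Ux.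
  by rewrite /U -bigcup_seq; exists j => //=; rewrite mem_index_enum.
have updk x : tnth (tuple_upd p k x) k = x by rewrite tnth_upd eqxx.
have updj x (j : 'I_N) : j != k -> tnth (tuple_upd p k x) j = tnth p j.
  by move=> jk; rewrite tnth_upd (negbTE jk).
have jltk (j : 'I_N) : (j < k)%N -> j != k by rewrite -val_eqE /= neq_ltn => ->.
rewrite /mass /placed; case: ifP => [/andP[kS ki0]|_].
  exists (dball dist (tnth p i0) r), (r / K); split; first exact: mball.
  - exact: divr_gt0.
  - apply: le_trans (ball_ge _ r0 r1); rewrite lee_fin.
    have rK : 0 <= (r / K) ^+ 2 by rewrite exprn_ge0 // divr_ge0 ?ltW.
    have := ler_wpM2r rK hK; have -> : c / 2 * K ^+ 2 * (r / K) ^+ 2 = c / 2 * r ^+ 2.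
      by field; lra.
    lra.
  move=> x xr xj; rewrite updk updj 1?eq_sym // xr /=.
  by apply/forallP => j; apply/implyP => /andP[jS jk]; rewrite updj ?jltk.
exists setT, rho; split => //.
  rewrite [P _]probability_setT lee_fin [leRHS](splitr 1) lerD2l; exact: hrho.
by move=> x _ xj; apply/forallP => j; apply/implyP => jk; rewrite updk updj ?jltk.
Qed.

(** The points are placed in the order of their indices. Resampling point [m] leaves the earlier
    factors unchanged, and the inner integral is at least [mass r k] for the index [k] of value
    [m]. *)
Lemma integral_placed_upto r m : 0 < r -> r <= 1 -> (m <= N)%N ->
  ((\prod_(i < N | (i < m)%N) mass r i)%:E <=
   \int[power_measure P N]_p (placed_upto r m p)%:E)%E.
Proof.
move=> r0 r1; elim: m => [_|m IH mN].
  rewrite big_pred0 //; under eq_integral => p _ do rewrite /placed_upto big_pred0 //.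
  by rewrite integral_prob_cst.
pose k := Ordinal mN.
have split_k (F : 'I_N -> R) :
    \prod_(i < N | (i < m.+1)%N) F i = (\prod_(i < N | (i < m)%N) F i) * F k.
  rewrite (bigD1 k) /=; last exact: ltnSn.
  rewrite mulrC; congr (_ * _); apply: eq_bigl => i.
  by rewrite ltnS -val_eqE /= andbC -ltn_neqAle.
have mass0 i : 0 <= mass r i.
  rewrite /mass; case: ifP => _; first last; first by rewrite divr_ge0.
  by rewrite mulr_ge0 ?divr_ge0 ?exprn_ge0 ?(ltW c0) ?(ltW r0).
rewrite split_k EFinM.
rewrite (integral_resample P k); last 2 first.
- apply/measurable_EFinP; exact: measurable_placed_upto.
- by move=> p; rewrite lee_fin placed_upto_ge0.
have uE p x : placed_upto r m.+1 (tuple_upd p k x) =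
    placed_upto r m p * (placed r k (tuple_upd p k x))%:R.
  rewrite /placed_upto split_k; congr (_ * _).
  by apply: eq_bigr => i im; rewrite placed_upd.
have mW := measurable_placed_upd r k.
have IE p : (\int[P]_x (placed_upto r m.+1 (tuple_upd p k x))%:E =
    (placed_upto r m p)%:E * \int[P]_x ((placed r k (tuple_upd p k x))%:R)%:E)%E.
  under eq_integral => x _ do rewrite uE EFinM.
  rewrite ge0_integralZl //.
  - exact/measurable_EFinP.
  - by rewrite lee_fin placed_upto_ge0.
apply: (@le_trans _ _ (\int[power_measure P N]_p ((mass r k)%:E * (placed_upto r m p)%:E))%E).
  rewrite ge0_integralZl //; last 3 first.
  - apply/measurable_EFinP; exact: measurable_placed_upto.
  - by move=> p _; rewrite lee_fin placed_upto_ge0.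
  - by rewrite lee_fin.
  by rewrite muleC lee_wpmul2l ?lee_fin // IH // ltnW.
apply: ge0_le_integral => //.
- by move=> p _; rewrite mule_ge0 ?lee_fin ?placed_upto_ge0.
- by apply: measurable_funeM; apply/measurable_EFinP; exact: measurable_placed_upto.
- apply: (@measurable_fun_fubini_tonelli_G _ _ _ _ _ P
    (fun xt : T * N.-tuple T => (placed_upto r m.+1 (tuple_upd xt.2 k xt.1))%:E)) => [|xt].
    apply/measurable_EFinP; apply: measurableT_comp; first exact: measurable_placed_upto.
    exact: measurable_tuple_upd.
  by rewrite lee_fin placed_upto_ge0.
move=> p _; rewrite IE muleC lee_wpmul2l ?lee_fin ?placed_upto_ge0 //.
exact: placed_mass.
Qed.

Lemma placed_uptoE r p : placed_upto r N p = [forall i, placed r i p]%:R.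
Proof.
rewrite /placed_upto; case: forallP => [h|/forallP].
  by rewrite big1 // => i _; rewrite h.
rewrite negb_forall => /existsP[i /negbTE hi].
by rewrite (bigD1 i) //= hi mul0r.
Qed.

Lemma prod_mass r : 0 < r -> \prod_(i < N | (i < N)%N) mass r i =
  (\prod_(i < N) mass 1 i) * r `^ (2 * #|S|.-1%:R).
Proof.
move=> r0; rewrite (eq_bigl xpredT) => [|i]; last exact: ltn_ord.
have -> : r `^ (2 * #|S|.-1%:R) = \prod_(i in S :\ i0) r ^+ 2.
  by rewrite prodr_const (cardsD1 i0 S) i0S /= -natrM powR_mulrn ?exprM // ltW.
rewrite big_mkcond /= [X in _ * X]big_mkcond /= -big_split /=; apply: eq_bigr => i _.
rewrite /mass !inE andbC; case: ifP => _; by rewrite ?expr1n ?mulr1.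
Qed.

(** Distances inside [S] lie between [r / K] and [2 r], all others between [rho / 2] and 2. Since
    [kappa] dominates the resulting ratios and their inverses, each factor loses at most [kappa] to
    the power [|a|]. *)
Lemma prod_dist_ge (a : 'I_N -> 'I_N -> R) kappa r p : 0 < r -> r <= rho / 2 ->
  K <= kappa -> 2 <= kappa -> 2 / rho <= kappa -> (forall i, placed r i p) ->
  (\prod_(e in pairs [set: 'I_N]%SET) kappa `^ (- `|a e.1 e.2|)) * r `^ pair_weight a S <=
  \prod_(e in pairs [set: 'I_N]%SET) dist (tnth p e.1) (tnth p e.2) `^ a e.1 e.2.
Proof.
move=> r0 rrho kK k2 krho pl.
have kpos : 0 < kappa by lra.
have Kpos : 0 < K := lt_le_trans ltr01 K1.
have powk (t b : R) : 1 <= kappa * t -> t <= kappa -> kappa `^ (- `|b|) <= t `^ b.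
  move=> kt tk.
  have t0 : 0 < t by rewrite -(pmulr_rgt0 _ kpos); lra.
  rewrite powRN invf_ple ?posrE ?powR_gt0 // -powRN.
  have [t1|t1] := lerP t 1.
    by rewrite -normrN; apply: powR_le_norm.
  rewrite -[- b]mulN1r powRrM powR_inv1 ?(ltW t0) //.
  apply: powR_le_norm; rewrite ?invr_gt0 //; first by rewrite invf_le1 // ltW.
  by rewrite ler_pdivlMr // mul1r.
have pS i : i \in S -> i != i0 -> dist (tnth p i) (tnth p i0) < r /\
    forall j : 'I_N, j \in S -> (j < i)%N -> r / K <= dist (tnth p i) (tnth p j).
  move=> iS ii0; have := pl i; rewrite /placed iS ii0 /= => /andP[-> /forallP h].
  by split => // j jS ji; have := h j; rewrite jS ji.
have pF i : ~~ ((i \in S) && (i != i0)) -> forall j : 'I_N, (j < i)%N ->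
    rho <= dist (tnth p i) (tnth p j).
  by move=> /negbTE iF j ji; have := pl i; rewrite /placed iF => /forallP/(_ j); rewrite ji.
have -> : r `^ pair_weight a S =
    \prod_(e in pairs [set: 'I_N]%SET) (if e \in pairs S then r `^ a e.1 e.2 else 1).
  rewrite /pair_weight -prod_powR // -big_mkcondr /=; apply: eq_bigl => e.
  rewrite !pairsE !finset.in_setT /=.
  by case: (_ < _)%N; rewrite ?andbT ?andbF.
rewrite -big_split /=; apply: ler_prod => e.
rewrite pairsE => /and3P[_ _ e12].
rewrite mulr_ge0 ?powR_ge0 //=; last by case: ifP => _; rewrite ?powR_ge0.
case: ifP => [|eS].
  rewrite pairsE => /and3P[e1 e2 _].
  (* The larger index of the pair is not the minimum of [S], so its separation from [e.1] is part of
     [placed]. *)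
  have e20 : e.2 != i0.
    by apply: contraTneq e12 => ->; rewrite -leqNgt i0min.
  have [d2 /(_ _ e1 e12) dK] := pS _ e2 e20.
  have d1 : dist (tnth p e.1) (tnth p e.2) <= 2 * r.
    have [->|e10] := eqVneq e.1 i0; first by rewrite dist_sym; lra.
    have [d1 _] := pS _ e1 e10.
    by have := dist_tri (tnth p e.1) (tnth p i0) (tnth p e.2); rewrite (dist_sym (tnth p i0)); lra.
  rewrite dist_sym in dK; set t := dist _ _ in d1 dK *.
  have -> : t = (t / r) * r by field; lra.
  have rK0 : 0 < r / K by apply: divr_gt0.
  have t0 : 0 <= t by lra.
  rewrite powRM ?divr_ge0 ?(ltW r0) // ler_wpM2r ?powR_ge0 //.
  apply: powk.
    apply: (@le_trans _ _ (K * (t / r))); last by rewrite ler_wpM2r // divr_ge0 // ltW.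
    by rewrite mulrA ler_pdivlMr // mul1r mulrC -ler_pdivrMr.
  by rewrite ler_pdivrMr //; nra.
rewrite mulr1; apply: powk; last by apply: le_trans k2.
suff dr : rho / 2 <= dist (tnth p e.1) (tnth p e.2).
  have := ler_wpM2l (ltW kpos) dr; apply: le_trans.
  by move: krho; rewrite ler_pdivrMr // => krho; lra.
have [e2|e2] := boolP ((e.2 \in S) && (e.2 != i0)); last first.
  by have := pF _ e2 _ e12; rewrite dist_sym; lra.
have [e2S e20] := andP e2; have [d2 _] := pS _ e2S e20.
have e1S : e.1 \notin S by move: eS; rewrite pairsE e2S e12 /= andbT => ->.
have e1F : ~~ ((e.1 \in S) && (e.1 != i0)) by rewrite (negbTE e1S).
(* As [e.2] is within [r <= rho / 2] of [i0], it suffices to separate [e.1] from [i0]; the one of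
   larger index carries the condition. *)
have d10 : rho <= dist (tnth p e.1) (tnth p i0).
  case: (ltngtP e.1 i0) => h.
  - by rewrite dist_sym; apply: pF h; rewrite eqxx andbF.
  - exact: pF.
  - by move/val_inj: h e1S => ->; rewrite i0S.
have := dist_tri (tnth p e.1) (tnth p e.2) (tnth p i0); lra.
Qed.

(** The distance from [j] to [i0] is at least [r / K] at scale [r] but less than [s] at scale
    [s]. *)
Lemma placed_disjoint r s p j : j \in S -> j != i0 -> s <= r / K ->
  (forall i, placed r i p) -> ~ (forall i, placed s i p).
Proof.
move=> jS j0 sr /(_ j) + /(_ j); rewrite /placed jS j0 /=.
move=> /andP[_ /forallP/(_ i0)]; rewrite i0S ltn_neqAle i0min // andbT.
rewrite eq_sym val_eqE j0 /= => h /andP[h' _]; lra.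
Qed.

Lemma integral_prod_dist_cluster (a : 'I_N -> 'I_N -> R) j : j \in S -> j != i0 ->
  pair_weight a S + 2 * #|S|.-1%:R <= 0 ->
  (\int[power_measure P N]_p (\prod_(e in pairs [set: 'I_N]%SET)
      dist (tnth p e.1) (tnth p e.2) `^ a e.1 e.2)%:E = +oo)%E.
Proof.
move=> jS j0 ha.
have Kpos : 0 < K := lt_le_trans ltr01 K1.
pose kappa := K + 2 + 2 / rho.
have rho2 : 0 < 2 / rho by apply: divr_gt0.
pose A := \prod_(e in pairs [set: 'I_N]%SET) kappa `^ (- `|a e.1 e.2|).
have A0 : 0 < A by apply: prodr_gt0 => e _; apply: powR_gt0; rewrite /kappa; lra.
have m1 : 0 < \prod_(i < N) mass 1 i.
  by apply: prodr_gt0 => i _; rewrite /mass; case: ifP => _; rewrite ?mulr_gt0 ?invr_gt0.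
(* The ratio [1 / (2 K)] makes every later scale at most [r k / K], as [placed_disjoint]
   requires. *)
pose r k := rho / 2 * (2 * K)^-1 ^+ k.
have K2 : 0 < (2 * K)^-1 by rewrite invr_gt0; lra.
have K21 : (2 * K)^-1 <= 1 by have := K1; rewrite invf_le1; lra.
have r0 k : 0 < r k by rewrite mulr_gt0 ?exprn_gt0 // divr_gt0.
have rr k : r k <= rho / 2 by rewrite ger_pMr ?exprn_ile1 ?(ltW K2) // divr_gt0.
have r1 k : r k <= 1 by have := rr k; have := rho1; have := rho0; lra.
have rlt k l : (k < l)%N -> r l <= r k / K.
  move=> kl; rewrite /r -[leRHS]mulrA ler_wpM2l ?divr_ge0 ?(ltW rho0) //.
  rewrite -(subnKC kl) exprD exprSr -mulrA ler_wpM2l ?exprn_ge0 ?(ltW K2) //.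
  apply: (@le_trans _ _ (2 * K)^-1); first by rewrite ger_pMr // exprn_ile1 // ltW.
  by rewrite lef_pV2 ?posrE; lra.
pose g k p : R := placed_upto (r k) N p * (A * r k `^ pair_weight a S).
have g0 k p : 0 <= g k p by rewrite !mulr_ge0 ?placed_upto_ge0 ?powR_ge0 // ltW.
have mg k : measurable_fun setT (g k).
  by apply: measurable_funM => //; exact: measurable_placed_upto.
(* The configurations at different scales are disjoint, so at most one term of the sum is nonzero at
   [p]. *)
have gle n p : \sum_(k < n) g k p <=
    \prod_(e in pairs [set: 'I_N]%SET) dist (tnth p e.1) (tnth p e.2) `^ a e.1 e.2.
  have f0 : 0 <= \prod_(e in pairs [set: 'I_N]%SET) dist (tnth p e.1) (tnth p e.2) `^ a e.1 e.2.
    by apply: prodr_ge0 => e _; apply: powR_ge0.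
  have [/existsP[k /forallP hk]|/existsPn h] :=
      boolP [exists k : 'I_n, [forall i, placed (r k) i p]].
    rewrite (bigD1 k) //= big1 => [|l lk].
      rewrite addr0 /g placed_uptoE; have -> : [forall i, placed (r k) i p] by apply/forallP.
      by rewrite mul1r; apply: prod_dist_ge => //; rewrite /kappa; lra.
    rewrite /g placed_uptoE; case: forallP => [hl|_]; last by rewrite mul0r.
    exfalso; move: lk; rewrite -val_eqE /= neq_ltn => /orP[lk|kl].
      exact: (placed_disjoint jS j0 (rlt _ _ lk) hl hk).
    exact: (placed_disjoint jS j0 (rlt _ _ kl) hk hl).
  by rewrite big1 // => k _; rewrite /g placed_uptoE (negbTE (h k)) mul0r.
(* The powers of [r k] from the integrand and from the measure combine to a nonpositive exponent,
   hence to a factor at least 1 as [r k <= 1]. *)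
have gint k : ((A * \prod_(i < N) mass 1 i)%:E <= \int[power_measure P N]_p (g k p)%:E)%E.
  under eq_integral => p _ do rewrite /g EFinM muleC.
  rewrite ge0_integralZl //; last 3 first.
  - apply/measurable_EFinP; exact: measurable_placed_upto.
  - by move=> p _; rewrite lee_fin placed_upto_ge0.
  - by rewrite lee_fin mulr_ge0 ?powR_ge0 // ltW.
  have := integral_placed_upto (r0 k) (r1 k) (leqnn N); rewrite prod_mass // => h.
  have w0 : 0 <= A * r k `^ pair_weight a S by rewrite mulr_ge0 ?powR_ge0 // ltW.
  apply: (le_trans _ (lee_wpmul2l _ h)); last by rewrite lee_fin.
  rewrite -EFinM lee_fin mulrACA [leLHS](_ : _ = A * (\prod_(i < N) mass 1 i) * 1) ?mulr1 //.
  rewrite [r k `^ _ * _](_ : _ = r k `^ (pair_weight a S + 2 * #|S|.-1%:R)); last first.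
    by rewrite powRD //; apply/implyP => _; rewrite gt_eqF.
  rewrite ler_peMr ?mulr_ge0 ?(ltW A0) ?(ltW m1) //.
  by rewrite -[leLHS](powRr0 (r k)) ger_powR // r0 r1.
apply/eqyP => B B0.
pose eta := A * \prod_(i < N) mass 1 i.
have eta0 : 0 < eta by apply: mulr_gt0.
pose n := (Num.truncn (B / eta)).+1.
apply: (@le_trans _ _ (\int[power_measure P N]_p (\sum_(k < n) (g k p)%:E))%E); last first.
  apply: ge0_le_integral => //.
  - by move=> p _; apply: sume_ge0 => k _; rewrite lee_fin.
  - by apply: emeasurable_sum => k; exact/measurable_EFinP.
  - apply/measurable_EFinP; apply: measurable_prod_cond => e _.
    apply: measurableT_comp (measurable_powR _) _; exact: measurable_dist_tnth.
  by move=> p _; rewrite sumEFin lee_fin.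
rewrite ge0_integral_sum //; last 2 first.
- by move=> k; exact/measurable_EFinP.
- by move=> k p _; rewrite lee_fin.
apply: (@le_trans _ _ (\sum_(k < n) eta%:E)%E); last by apply: lee_sum => k _; exact: gint.
rewrite sumEFin lee_fin sumr_const card_ord -mulr_natl -ler_pdivrMr //.
by apply/ltW; exact: truncnS_gt.
Qed.

End Necessity.

Lemma integral_prod_dist_pinfty (d : measure_display) (T : measurableType d) (R : realType)
    (P : probability T R) (dist : T -> T -> R) (C c : R)
    (N : nat) (S : {set 'I_N}) (a : 'I_N -> 'I_N -> R) :
  measurable_fun setT (fun xy : T * T => dist xy.1 xy.2) ->
  (forall x y, dist x y = dist y x) ->
  (forall x y z, dist x z <= dist x y + dist y z) ->
  (forall x y, dist x y <= 2) ->
  (forall x (r : R), 0 < r -> (P (dball dist x r) <= (C * r ^+ 2)%:E)%E) ->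
  (forall x (r : R), 0 < r -> r <= 1 -> ((c * r ^+ 2)%:E <= P (dball dist x r))%E) ->
  0 < c -> (1 < #|S|)%N -> pair_weight a S + 2 * #|S|.-1%:R <= 0 ->
  (\int[power_measure P N]_p (\prod_(e in pairs [set: 'I_N]%SET)
      dist (tnth p e.1) (tnth p e.2) `^ a e.1 e.2)%:E = +oo)%E.
Proof.
move=> mdist dsym dtri d2 ble bge c0 S1 ha.
have C0 := ball_cst_ge0 ble.
have /card_gt1P[x [y [xS yS xy]]] := S1.
case: (arg_minnP (fun i : 'I_N => i : nat) xS) => i0 i0S i0min.
have [j [jS j0]] : exists j, j \in S /\ j != i0.
  have [xi|xi] := eqVneq x i0; last by exists x.
  by exists y; rewrite yS -xi eq_sym.
have NC0 : 0 <= N%:R * C by rewrite mulr_ge0.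
(* Then [N C = c / 2 * (K - 1)], which is at most [c / 2 * K^2]. *)
pose K := 1 + 2 * (N%:R * C) / c.
have K1 : 1 <= K by rewrite lerDl !mulr_ge0 ?invr_ge0 ?(ltW c0).
have hK : N%:R * C <= c / 2 * K ^+ 2.
  have -> : N%:R * C = c / 2 * (K - 1) by rewrite /K; field; lra.
  rewrite ler_wpM2l ?divr_ge0 ?(ltW c0) //; nra.
pose rho := (2 * (N%:R * C + 1))^-1.
have rho0 : 0 < rho by rewrite invr_gt0; lra.
have rho1 : rho <= 1 by rewrite invf_le1; lra.
have hrho : N%:R * (C * rho ^+ 2) <= 1 / 2.
  have E : rho * (2 * (N%:R * C + 1)) = 1 by rewrite mulVf //; lra.
  rewrite mulrA; nra.
exact: (integral_prod_dist_cluster mdist dsym dtri d2 ble bge c0 i0S i0min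
  K1 hK rho0 rho1 hrho jS j0 ha).
Qed.

(** * Caps of the sphere *)

(** Addition in ['I_3] is cyclic, so any chosen coordinate can be listed first. *)
Lemma sum_ord3 (R : realType) (F : 'I_3 -> R) (i : 'I_3) :
  \sum_k F k = F i + F (i + 1) + F (i + 1 + 1).
Proof.
rewrite !big_ord_recl big_ord0 addr0.
case: i => [[|[|[|//]]] hi].
- by rewrite addrA; congr (F _ + F _ + F _); apply/val_inj.
- rewrite addrC; congr (_ + F _); last by apply/val_inj.
  by congr (F _ + F _); apply/val_inj.
- rewrite addrA addrC addrA; congr (F _ + F _ + F _); exact/val_inj.
Qed.

(** The matrix determinant lemma: [A *m B = D *m A] with [\det A = 1], and [B], [D] are block
    triangular. *)
Lemma det_1Dmulmx (R : comNzRingType) n (u : 'cV[R]_n) (v : 'rV[R]_n) :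
  \det (1%:M + u *m v) = 1 + (v *m u) 0 0.
Proof.
pose A := block_mx (1%:M : 'M[R]_n) 0 v 1%:M.
pose B := block_mx (1%:M + u *m v) u 0 (1%:M : 'M[R]_1).
pose D := block_mx (1%:M : 'M[R]_n) u 0 (1%:M + v *m u).
have E : A *m B = D *m A.
  rewrite /A /B /D !mulmx_block !mul1mx !mulmx1 !mul0mx ?mulmx0 ?addr0 ?add0r.
  by rewrite mulmxDr mulmxDl mulmxA mul1mx mulmx1 [v *m u + _]addrC.
have := congr1 determinant E; rewrite !det_mulmx.
rewrite /A /B /D det_lblock !det_ublock !det1 !mul1r !mulr1 => ->.
by rewrite det_mx11 !mxE eqxx.
Qed.

Section Chordal.
Variable R : realType.
Implicit Types p q : sphere R.

Lemma chordal_ge0 p q : 0 <= chordal_dist p q.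
Proof. exact: sqrtr_ge0. Qed.

Lemma chordalxx p : chordal_dist p p = 0.
Proof. by rewrite /chordal_dist big1 ?sqrtr0 // => i _; rewrite subrr expr0n. Qed.

Lemma chordal_sym p q : chordal_dist p q = chordal_dist q p.
Proof. by congr Num.sqrt; apply: eq_bigr => i _; rewrite -sqrrN opprB. Qed.

Lemma chordal_sqr p q : chordal_dist p q ^+ 2 = \sum_i (val p 0 i - val q 0 i) ^+ 2.
Proof. by rewrite sqr_sqrtr // sumr_ge0 // => i _; rewrite sqr_ge0. Qed.

Lemma sphere_sqr p : \sum_i val p 0 i ^+ 2 = 1.
Proof. exact/eqP/(valP p). Qed.

Lemma sphere_big_coord p : exists i, 1 <= 3 * val p 0 i ^+ 2.
Proof.
apply/existsP; rewrite -[X in is_true X]negbK negb_exists; apply/forallP => h.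
have := sphere_sqr p; rewrite (sum_ord3 _ 0).
by have := h 0; have := h (0 + 1); have := h (0 + 1 + 1); rewrite -!ltNge; lra.
Qed.

Lemma chordal_tri p q (r : sphere R) : chordal_dist p r <= chordal_dist p q + chordal_dist q r.
Proof.
have h1 := chordal_ge0 p q; have h2 := chordal_ge0 q r.
rewrite -(@ler_sqr _ (chordal_dist p r)) ?nnegrE ?addr_ge0 ?chordal_ge0 //.
rewrite sqrrD !chordal_sqr !(sum_ord3 _ 0).
have hm : 0 <= chordal_dist p q * chordal_dist q r by apply: mulr_ge0.
have := congr2 *%R (chordal_sqr p q) (chordal_sqr q r).
rewrite -exprMn !(sum_ord3 _ 0); move: hm; set m := _ * _ => hm.
move: (val p 0 _) (val p 0 _) (val p 0 _) (val q 0 _) (val q 0 _) (val q 0 _)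
  (val r 0 _) (val r 0 _) (val r 0 _) => a1 a2 a3 b1 b2 b3 c1 c2 c3 hE.
(* After squaring, the triangle inequality becomes Cauchy-Schwarz, proved below by Lagrange's
   identity. *)
suff : (a1 - b1) * (b1 - c1) + (a2 - b2) * (b2 - c2) + (a3 - b3) * (b3 - c3) <= m by lra.
set s := (X in X <= m); have [s0|s0] := lerP s 0; first exact: le_trans hm.
rewrite -ler_sqr ?nnegrE ?(ltW s0) // hE -subr_ge0.
rewrite [leRHS](_ : _ = ((a1 - b1) * (b2 - c2) - (a2 - b2) * (b1 - c1)) ^+ 2 +
  ((a1 - b1) * (b3 - c3) - (a3 - b3) * (b1 - c1)) ^+ 2 +
  ((a2 - b2) * (b3 - c3) - (a3 - b3) * (b2 - c2)) ^+ 2); last by rewrite /s; ring.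
by rewrite !addr_ge0 ?sqr_ge0.
Qed.

Lemma chordal_le2 p q : chordal_dist p q <= 2.
Proof.
rewrite -(@ler_sqr _ (chordal_dist p q)) ?nnegrE ?chordal_ge0 // chordal_sqr.
have := sphere_sqr p; have := sphere_sqr q; rewrite !(sum_ord3 _ 0).
move: (val p 0 _) (val p 0 _) (val p 0 _) (val q 0 _) (val q 0 _) (val q 0 _).
move=> a1 a2 a3 b1 b2 b3 hb ha.
have := sqr_ge0 (a1 + b1); have := sqr_ge0 (a2 + b2); have := sqr_ge0 (a3 + b3); lra.
Qed.

Lemma measurable_sphere_coord i : measurable_fun setT (@sphere_coord R i).
Proof.
move=> _ Y mY; rewrite setTI; apply: sub_sigma_algebra => /=.
rewrite -bigcup_seq /=; exists i => /=; first by rewrite mem_index_enum.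
by exists Y => //; rewrite setTI.
Qed.

Lemma measurable_chordal :
  measurable_fun setT (fun pq : sphere R * sphere R => chordal_dist pq.1 pq.2).
Proof.
apply: measurableT_comp (continuous_measurable_fun (@sqrt_continuous R)) _.
apply: measurable_sum => i; apply: measurable_funX; apply: measurable_funB.
  exact: measurableT_comp (measurable_sphere_coord i) (@measurable_fst _ _ _ _).
exact: measurableT_comp (measurable_sphere_coord i) (@measurable_snd _ _ _ _).
Qed.

Lemma sum_sqr_mulmx (x : 'rV[R]_3) : \sum_i x 0 i ^+ 2 = (x *m x^T) 0 0.
Proof. by rewrite mxE; apply: eq_bigr => i _; rewrite mxE expr2. Qed.

Lemma chordal_rotate (A : 'M[R]_3) (hA : rotation A) p q :
  chordal_dist (rotate hA p) (rotate hA q) = chordal_dist p q.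
Proof.
congr Num.sqrt.
have E (x y : 'rV[R]_3) : \sum_i (x 0 i - y 0 i) ^+ 2 = ((x - y) *m (x - y)^T) 0 0.
  by rewrite -sum_sqr_mulmx; apply: eq_bigr => i _; rewrite !mxE.
rewrite !E /= -mulmxBl trmx_mul mulmxA -(mulmxA _ A).
by case: (hA) => -> _; rewrite mulmx1.
Qed.

(* The half-turn about the axis [p + q] exchanges [p] and [q]. *)
Lemma half_turn p q : val p + val q != 0 ->
  exists (A : 'M[R]_3) (hA : rotation A), rotate hA p = q.
Proof.
set v := val p + val q => v0.
pose s := (v *m v^T) 0 0.
have sE : v *m v^T = s%:M by rewrite [LHS]mx11_scalar.
have s0 : s != 0.
  apply: contra v0 => /eqP; rewrite /s -sum_sqr_mulmx => /eqP.
  rewrite psumr_eq0 => [/allP h|i _]; last exact: sqr_ge0.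
  apply/eqP/rowP => i; apply/eqP; rewrite [X in _ == X]mxE.
  by have := h i (mem_index_enum i); rewrite /= sqrf_eq0.
pose k := 2 / s.
pose W := v^T *m v.
have WW : W *m W = s *: W.
  by rewrite /W mulmxA -(mulmxA v^T) sE -mulmxA mul_scalar_mx -scalemxAr.
have WT : W^T = W by rewrite /W trmx_mul trmxK.
pose A := k *: W - 1%:M.
have hA : rotation A.
  split.
    rewrite /A linearB /= linearZ /= WT trmx1.
    have XX : (k *: W) *m (k *: W) = k *: W + k *: W.
      rewrite -scalemxAl -scalemxAr WW !scalerA -scalerDl; congr (_ *: _).
      by rewrite /k; field.
    by rewrite mulmxBl mulmxBr mul1mx mulmx1 XX addrK opprB addrC subrK.
  (* The determinant is [(-1)^3 (1 - k s)], and [k s = 2]. *)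
  rewrite /A -opprB -scaleN1r detZ.
  have -> : 1%:M - k *: W = 1%:M + (- k *: v^T) *m v :> 'M[R]_3.
    by rewrite /W -scalemxAl scaleNr.
  rewrite det_1Dmulmx -scalemxAr mxE -/s.
  by rewrite /k; field.
exists A, hA; apply/val_inj => /=.
have nE (x : sphere R) : val x *m (val x)^T = 1%:M.
  by rewrite [LHS]mx11_scalar -sum_sqr_mulmx sphere_sqr.
(* As [p] and [q] have equal norm, the projection of [p] on the axis is [v / 2], so [p] is sent to
   [v - p = q]. *)
have pv : val p *m v^T = (s / 2)%:M.
  have pq : val q *m (val p)^T = val p *m (val q)^T.
    by rewrite -[LHS]trmxK [in LHS]trmx_mul trmxK; apply/matrixP => i j; rewrite !ord1 mxE.
  have : s%:M = val p *m v^T *+ 2.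
    rewrite -sE /v linearD /= mulmxDl !mulmxDr !nE pq mulr2n.
    by rewrite addrACA [X in _ + X]addrC.
  move=> h; apply/matrixP => i j; rewrite !ord1 [RHS]mxE eqxx.
  move: (congr1 (fun m : 'M[R]_1 => m 0 0) h); rewrite mulr2n [LHS]mxE [RHS]mxE eqxx mulr1n => ->.
  by rewrite mulr1n; field.
rewrite /A mulmxBr mulmx1 -scalemxAr /W mulmxA pv mul_scalar_mx scalerA.
have -> : k * (s / 2) = 1 by rewrite /k; field.
by rewrite scale1r /v addrC addKr.
Qed.

Lemma measurable_cap p (r : R) : measurable (dball (@chordal_dist R) p r).
Proof. exact: measurable_dball measurable_chordal p r. Qed.

(** * Two-sided bounds for the measure of caps *)

Section Caps.
Local Open Scope classical_set_scope.
Variable V : probability (sphere R) R.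
Hypothesis hV : rotation_invariant V.

Lemma cap_half_turn p q (r : R) : val p + val q != 0 ->
  V (dball (@chordal_dist R) p r) = V (dball (@chordal_dist R) q r).
Proof.
move=> /half_turn[A [hA Apq]]; rewrite -(hV hA (measurable_cap q r)); congr (V _).
by apply/seteqP; split => x /=; rewrite /dball /= -Apq chordal_rotate.
Qed.

Lemma unit_delta (i : 'I_3) : unit_vector (delta_mx 0 i : 'rV[R]_3).
Proof.
rewrite /unit_vector (bigD1 i) //= mxE !eqxx /= expr1n big1 ?addr0 // => j ji.
by rewrite mxE (negPf ji) andbF /= expr0n.
Qed.

(** For antipodal points [p + q] gives no axis; two half-turns through a basis vector antipodal to
    neither are used instead. *)
Lemma cap_eq p q (r : R) :
  V (dball (@chordal_dist R) p r) = V (dball (@chordal_dist R) q r).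
Proof.
have [pq|pq] := eqVneq (val p + val q) 0; last exact: cap_half_turn.
suff [m [pm qm]] : exists m : sphere R, val p + val m != 0 /\ val q + val m != 0.
  by rewrite (cap_half_turn r pm) (cap_half_turn r qm).
pose m i : sphere R := exist (@unit_vector R) _ (unit_delta i).
have mE i j : val (m i) 0 j = (j == i)%:R by rewrite /= mxE.
have qE j : val q 0 j = - val p 0 j.
  by apply/eqP; rewrite -addr_eq0 addrC; move/rowP: pq => /(_ j); rewrite !mxE => ->.
have key i j : val p 0 i != 0 -> j != i -> val p + val (m j) != 0 /\ val q + val (m j) != 0.
  move=> pi ji; have h (x : 'rV[R]_3) : x 0 i != 0 -> x + val (m j) != 0.
    apply: contra => /eqP/rowP/(_ i); rewrite mxE mE eq_sym (negbTE ji) addr0 => ->.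
    by rewrite mxE.
  by split; apply: h => //; rewrite qE oppr_eq0.
have [i pi] : exists i, val p 0 i != 0.
  have [i hi] := sphere_big_coord p; exists i.
  by apply: contraTneq hi => ->; rewrite expr0n mulr0 ler10.
exists (m (i + 1)); apply: (key i) => //.
by rewrite -subr_eq0 addrAC subrr add0r oner_eq0.
Qed.

Let vol p r : R := fine (V (dball (@chordal_dist R) p r)).

Let volE p r : V (dball (@chordal_dist R) p r) = (vol p r)%:E.
Proof. by rewrite fineK // fin_num_measure //; exact: measurable_cap. Qed.

Let vol_le p (r s : R) : r <= s -> vol p r <= vol p s.
Proof.
move=> rs; rewrite -lee_fin -!volE; apply: le_measure; rewrite ?inE.
- exact: measurable_cap.
- exact: measurable_cap.
- by move=> x /= h; apply: lt_le_trans rs.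
Qed.

Lemma coord_le_chordal p q i : `|val p 0 i - val q 0 i| <= chordal_dist p q.
Proof.
rewrite -ler_sqr ?nnegrE ?chordal_ge0 // real_normK ?num_real // chordal_sqr.
rewrite (bigD1 i) //= lerDl sumr_ge0 // => j _; exact: sqr_ge0.
Qed.

Lemma sphere_of_coords (u v w : R) : u ^+ 2 + v ^+ 2 + w ^+ 2 = 1 ->
  exists x : sphere R, val x 0 ord0 = u /\ val x 0 (lift ord0 ord0) = v.
Proof.
move=> uvw; have hx : unit_vector (\row_(i < 3) [:: u; v; w]`_i).
  by rewrite /unit_vector !big_ord_recl big_ord0 !mxE /= addr0 addrA uvw.
by exists (exist (@unit_vector R) _ hx); rewrite /= !mxE.
Qed.

(** Lift to the sphere the [n^2] points of a grid of mesh [h = 1 / (2 n)] in the square of side one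
    half. Coordinates are 1-Lipschitz, so the lifts are at least [h] apart and the caps of radius
    [h / 2] are disjoint; they have equal measure. *)
Lemma cap_lattice_pack n p : (0 < n)%N -> n%:R ^+ 2 * vol p (4 * n%:R)^-1 <= 1.
Proof.
move=> n0; have nR : 0 < n%:R :> R by rewrite ltr0n.
pose h : R := (2 * n%:R)^-1.
have h0 : 0 < h by rewrite invr_gt0 mulr_gt0.
have hn (a : 'I_n) : 0 <= a%:R * h <= 2^-1.
  rewrite mulr_ge0 ?(ltW h0) //= /h ler_pdivrMr ?mulr_gt0 // mulrA mulVf // mul1r.
  by rewrite ler_nat ltnW.
have ex (ab : 'I_n * 'I_n) : exists x : sphere R,
    val x 0 ord0 = ab.1%:R * h /\ val x 0 (lift ord0 ord0) = ab.2%:R * h.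
  have /andP[u0 u1] := hn ab.1; have /andP[v0 v1] := hn ab.2.
  apply: (@sphere_of_coords _ _ (Num.sqrt (1 - (ab.1%:R * h) ^+ 2 - (ab.2%:R * h) ^+ 2))).
  rewrite sqr_sqrtr; first by ring.
  nra.
have [f hf] := choice ex.
pose F ab := dball (@chordal_dist R) (f ab) (4 * n%:R)^-1.
have mF ab : measurable (F ab) by exact: measurable_cap.
have natd (a b : 'I_n) : a != b -> h <= `|a%:R * h - b%:R * h|.
  move=> ab; rewrite -mulrBl normrM (gtr0_norm h0) ler_peMl ?(ltW h0) //.
  rewrite ler_normr; case: (ltngtP a b) => [l|l|/val_inj e].
  - by have : a%:R + 1 <= b%:R :> R by [rewrite natr1 ler_nat]; lra.
  - by have : b%:R + 1 <= a%:R :> R by [rewrite natr1 ler_nat]; lra.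
  - by rewrite e eqxx in ab.
have tF ab cd : ab != cd -> F ab `&` F cd = set0.
  move=> abcd; apply/seteqP; split => // x [/= h1 h2].
  have hd : chordal_dist (f ab) (f cd) < h.
    apply: le_lt_trans (chordal_tri _ x _) _; rewrite (chordal_sym (f ab)).
    have -> : h = (4 * n%:R)^-1 + (4 * n%:R)^-1 by rewrite /h; field; lra.
    exact: ltrD.
  have [a1 a2] := hf ab; have [c1 c2] := hf cd.
  have [e1|n1] := eqVneq ab.1 cd.1.
    have n2 : ab.2 != cd.2.
      by apply: contra abcd => /eqP e2; rewrite [ab]surjective_pairing e1 e2 -surjective_pairing.
    have := coord_le_chordal (f ab) (f cd) (lift ord0 ord0); rewrite a2 c2.
    by have := natd _ _ n2; lra.
  have := coord_le_chordal (f ab) (f cd) ord0; rewrite a1 c1.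
  by have := natd _ _ n1; lra.
have add (s : seq ('I_n * 'I_n)) : uniq s ->
    V (\big[setU/set0]_(ab <- s) F ab) = (\sum_(ab <- s) V (F ab))%E.
  elim: s => [_|x s IH /= /andP[xs us]]; first by rewrite !big_nil measure0.
  rewrite !big_cons measureU //; [by congr (_ + _)%E; apply: IH|by apply: bigsetU_measurable|].
  rewrite -bigcup_seq; apply/seteqP; split => // y [Fx [z /= zs Fz]].
  have : (F x `&` F z) y by split.
  by rewrite tF //; apply: contraNneq xs => ->.
have mU : measurable (\big[setU/set0]_(ab <- index_enum ('I_n * 'I_n)%type) F ab).
  exact: bigsetU_measurable.
have := probability_le1 V mU.
rewrite add ?index_enum_uniq //.
rewrite (eq_bigr (fun=> (vol p (4 * n%:R)^-1)%:E)) => [|ab _]; last first.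
  by rewrite /F (cap_eq _ p) volE.
by rewrite sumEFin lee_fin sumr_const card_prod card_ord -[vol _ _ *+ _]mulr_natl natrM expr2.
Qed.

Lemma cap_le p (r : R) : 0 < r -> (V (dball (@chordal_dist R) p r) <= (64 * r ^+ 2)%:E)%E.
Proof.
move=> r0; pose n := Num.truncn (4 * r)^-1.
have r4 : 0 < (4 * r)^-1 by rewrite invr_gt0 mulr_gt0.
have /andP[n1 n2] := truncn_itv (ltW r4); rewrite -/n in n1 n2.
have r1 : (4 * r)^-1 * (4 * r) = 1 by rewrite mulVf //; lra.
have [n0|n0] := posnP n.
  apply: le_trans (probability_le1 V (measurable_cap _ _)) _.
  by rewrite lee_fin; rewrite n0 in n2; nra.
have nR : 1 <= n%:R :> R by rewrite ler1n.
have rn : r <= (4 * n%:R)^-1 by rewrite -[r]invrK lef_pV2 ?posrE; nra.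
rewrite volE lee_fin.
have h1 := cap_lattice_pack p n0; have h2 := vol_le p rn.
have h3 : 1 <= 8 * r * n%:R.
  have r40 : 0 <= 4 * r by rewrite mulr_ge0 // ltW.
  rewrite -[n.+1%:R]natr1 in n2.
  have h : (4 * r)^-1 * (4 * r) <= (n%:R + 1) * (4 * r) by rewrite ler_wpM2r // ltW.
  rewrite r1 in h.
  have nr : 0 <= (n%:R - 1) * r by rewrite mulr_ge0 ?subr_ge0 // ltW.
  lra.
have v0 : 0 <= vol p (4 * n%:R)^-1 by rewrite fine_ge0.
apply: (le_trans h2); set v := vol _ _ in h1 v0 *.
have n20 : 0 < n%:R ^+ 2 :> R by rewrite exprn_gt0 //; lra.
rewrite -(ler_pM2l n20); apply: (le_trans h1).
have : 1 <= (8 * r * n%:R) ^+ 2 by rewrite exprn_ege1.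
by rewrite !exprMn; lra.
Qed.

(* On a cell the coordinate [i] is a Lipschitz function of the other two. *)
Let grid_cell n (k : 'I_3 * bool * 'I_n.*2.+1 * 'I_n.*2.+1) (x : sphere R) : Prop :=
  let: (i, s, a, b) := k in
  [/\ 1 <= 3 * val x 0 i ^+ 2, (0 <= val x 0 i) = s,
      Num.truncn (n%:R * (val x 0 (i + 1)%R + 1)) = a &
      Num.truncn (n%:R * (val x 0 (i + 1 + 1)%R + 1)) = b].

Let coord_le1 (x : sphere R) i : -1 <= val x 0 i <= 1.
Proof.
rewrite -ler_norml -ler_sqr ?nnegrE // expr1n real_normK ?num_real // -(sphere_sqr x).
by rewrite [leRHS](bigD1 i) //= lerDl sumr_ge0 // => j _; exact: sqr_ge0.
Qed.

Let grid_cover n x : exists k, grid_cell (n := n) k x.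
Proof.
have [i hi] := sphere_big_coord x.
(* The value [2 n] is reached at [t = 1], hence [2 n + 1] indices per coordinate. *)
have hb (t : R) : -1 <= t <= 1 -> (Num.truncn (n%:R * (t + 1)) < n.*2.+1)%N.
  move=> /andP[t1 t2]; rewrite ltnS truncn_le_nat.
  have n0 : 0 <= n%:R :> R by rewrite ler0n.
  by rewrite -[n.*2.+1%:R]natr1 -muln2 natrM; nra.
exists (i, 0 <= val x 0 i, Ordinal (hb _ (coord_le1 x (i + 1))),
  Ordinal (hb _ (coord_le1 x (i + 1 + 1)))).
by split.
Qed.

(** The last two coordinates differ by at most [1 / n] each. The first ones have equal sign and
    squares at least [1 / 3], so [(a1 + b1)^2 >= 4 / 3]; the equation of the sphere and
    Cauchy-Schwarz then bound [(a1 - b1)^2] by twice the other two squared differences. The total is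
    at most [6 / n^2 < 16 / n^2]. *)
Let grid_small n k x y : (0 < n)%N -> grid_cell (n := n) k x -> grid_cell k y ->
  chordal_dist x y < 4 / n%:R.
Proof.
case: k => [[[i s] a] b] n0 [xi xs xa xb] [yi ys ya yb].
have nR : 0 < n%:R :> R by rewrite ltr0n.
rewrite -(@ltr_sqr _ (chordal_dist x y)) ?nnegrE ?chordal_ge0 ?divr_ge0 ?ltW //.
rewrite chordal_sqr (sum_ord3 _ i).
have := sphere_sqr x; have := sphere_sqr y; rewrite !(sum_ord3 _ i).
have close (t u : R) : -1 <= t <= 1 -> -1 <= u <= 1 ->
    Num.truncn (n%:R * (t + 1)) = Num.truncn (n%:R * (u + 1)) -> n%:R ^+ 2 * (t - u) ^+ 2 <= 1.
  move=> /andP[t1 t2] /andP[u1 u2] tu.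
  have t0 : 0 <= n%:R * (t + 1) by rewrite mulr_ge0 ?(ltW nR) //; lra.
  have u0 : 0 <= n%:R * (u + 1) by rewrite mulr_ge0 ?(ltW nR) //; lra.
  have /andP[e1 e2] := truncn_itv t0; have /andP[e3 e4] := truncn_itv u0.
  rewrite tu in e1 e2; rewrite -natr1 in e2 e4.
  rewrite -exprMn -[leRHS](expr1n _ 2) -real_normK ?num_real // ler_sqr ?nnegrE //.
  by rewrite ler_norml; apply/andP; split; lra.
have := close _ _ (coord_le1 x (i + 1)) (coord_le1 y (i + 1)) (etrans xa (esym ya)).
have := close _ _ (coord_le1 x (i + 1 + 1)) (coord_le1 y (i + 1 + 1)) (etrans xb (esym yb)).
move: xi yi xs ys; clear -nR; rewrite expr_div_n ltr_pdivlMr ?exprn_gt0 //.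
move: (val x 0 i) (val x 0 (i + 1)) (val x 0 (i + 1 + 1))
  (val y 0 i) (val y 0 (i + 1)) (val y 0 (i + 1 + 1)).
move=> a1 a2 a3 b1 b2 b3 ha hb sa sb h3 h2 hy hx.
set m : R := n%:R in nR h2 h3 *.
have ab0 : 0 <= a1 * b1.
  have sab : (0 <= a1) = (0 <= b1) by rewrite sa sb.
  case: (lerP 0 a1) sab => a0 /esym; first exact: mulr_ge0.
  by move=> /negbT; rewrite -ltNge => b0; rewrite -mulrNN mulr_ge0 ?oppr_ge0 ?(ltW a0) ?(ltW b0).
have ab1 : 1 <= 3 * (a1 * b1).
  have ab3 : 0 <= 3 * (a1 * b1) by rewrite mulr_ge0.
  rewrite -(@ler_sqr _ 1) ?nnegrE //.
  rewrite (_ : (3 * (a1 * b1)) ^+ 2 = (3 * a1 ^+ 2) * (3 * b1 ^+ 2)); last by ring.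
  by rewrite expr1n -[leLHS]mulr1 ler_pM.
have s1 : 4 / 3 <= (a1 + b1) ^+ 2 by have := ha; have := hb; have := ab1; lra.
have p0 := addr_ge0 (sqr_ge0 (a2 - b2)) (sqr_ge0 (a3 - b3)).
have h : (a1 - b1) ^+ 2 * (a1 + b1) ^+ 2 <=
    ((a2 - b2) ^+ 2 + (a3 - b3) ^+ 2) * ((a2 + b2) ^+ 2 + (a3 + b3) ^+ 2).
  have e : (a1 - b1) * (a1 + b1) = - ((a2 - b2) * (a2 + b2) + (a3 - b3) * (a3 + b3)) by lra.
  rewrite -exprMn e sqrrN -subr_ge0 [leRHS](_ : _ =
    ((a2 - b2) * (a3 + b3) - (a3 - b3) * (a2 + b2)) ^+ 2); last by ring.
  exact: sqr_ge0.
have q1 : (a2 + b2) ^+ 2 + (a3 + b3) ^+ 2 <= 8 / 3.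
  by have := sqr_ge0 (a2 - b2); have := sqr_ge0 (a3 - b3); have := ha; have := hb; lra.
have h' := ler_wpM2l p0 q1.
have h'' := ler_wpM2l (sqr_ge0 (a1 - b1)) s1.
have x1 : (a1 - b1) ^+ 2 <= 2 * ((a2 - b2) ^+ 2 + (a3 - b3) ^+ 2).
  move: (le_trans h'' (le_trans h h')); move: ((a1 - b1) ^+ 2) (_ + _) => u v; lra.
have := ler_wpM2r (sqr_ge0 m) x1; lra.
Qed.

Lemma cap_grid_cover n p : (0 < n)%N -> 1 <= 6 * (2 * n%:R + 1) ^+ 2 * vol p (4 / n%:R).
Proof.
move=> n0.
(* Each of the [3 * 2 * (2 n + 1)^2] cells gets one of its own points as centre, an empty cell an
   arbitrary one. *)
have ex k : exists c : sphere R, forall x, grid_cell (n := n) k x -> grid_cell k c.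
  have [[c hc]|h] := pselect (exists c, grid_cell (n := n) k c); first by exists c.
  by exists point => x hx; exfalso; apply: h; exists x.
have [f hf] := choice ex.
pose F k := dball (@chordal_dist R) (f k) (4 / n%:R).
have mF k : measurable (F k) by exact: measurable_cap.
have cov : setT `<=` \big[setU/set0]_(k <- index_enum _) F k.
  move=> x _; have [k hk] := grid_cover n x.
  rewrite -bigcup_seq; exists k => /=; first by rewrite mem_index_enum.
  exact: (grid_small n0 hk (hf _ _ hk)).
have : (V setT <= V (\big[setU/set0]_(k <- index_enum _) F k))%E.
  by apply: le_measure => //; rewrite inE //; exact: bigsetU_measurable.
rewrite [V setT]probability_setT => /le_trans/(_ (measure_bigsetU_le V _ mF)).
rewrite (eq_bigr (fun=> (vol p (4 / n%:R))%:E)) => [|k _]; last first.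
  exact: etrans (cap_eq (f k) p _) (volE p _).
rewrite sumEFin lee_fin sumr_const !card_prod !card_ord card_bool -[vol _ _ *+ _]mulr_natl.
by rewrite !natrM -[n.*2.+1%:R]natr1 -muln2 natrM; lra.
Qed.

Lemma cap_ge p (r : R) : 0 < r -> r <= 1 ->
  (((6 * 11 ^+ 2)^-1 * r ^+ 2)%:E <= V (dball (@chordal_dist R) p r))%E.
Proof.
move=> r0 r1; rewrite volE lee_fin.
(* Then [4 / n < r] and [n r <= 4 + r], so [(2 n + 1) r <= 8 + 3 r <= 11]. *)
pose n := (Num.truncn (4 / r)).+1.
have r4 : 0 <= 4 / r by rewrite divr_ge0 // ltW.
have /andP[n1 n2] := truncn_itv r4; rewrite -/n in n2.
have nR : 0 < n%:R :> R by rewrite ltr0n.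
have h1 := @cap_grid_cover n p isT.
have h2 : vol p (4 / n%:R) <= vol p r.
  by apply: vol_le; rewrite ler_pdivrMr // mulrC -ler_pdivrMr // ltW.
have n3 : (2 * n%:R + 1) * r <= 11.
  have : n%:R * r <= (4 / r + 1) * r by rewrite ler_pM2r // /n -[_.+1%:R]natr1 lerD2r.
  by rewrite mulrDl divfK ?gt_eqF //; lra.
have h3 : 1 <= 6 * (2 * n%:R + 1) ^+ 2 * vol p r.
  apply: (le_trans h1); rewrite ler_wpM2l // mulr_ge0 // sqr_ge0 //.
have h4 : ((2 * n%:R + 1) * r) ^+ 2 <= 11 ^+ 2.
  by rewrite ler_sqr ?nnegrE // mulr_ge0 ?addr_ge0 ?mulr_ge0 ?(ltW nR) ?(ltW r0).
have v0 : 0 <= vol p r by rewrite fine_ge0.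
rewrite mulrC ler_pdivrMr ?mulr_gt0 ?exprn_gt0 //.
apply: (@le_trans _ _ (6 * (2 * n%:R + 1) ^+ 2 * vol p r * r ^+ 2)).
  by rewrite ler_peMl // sqr_ge0.
have := ler_wpM2r v0 h4; rewrite exprMn; lra.
Qed.

End Caps.
End Chordal.

(** * The thresholds *)

Section Threshold.
Variables (R : realType) (N : nat) (c : 'I_N -> 'I_N -> R) (beta : R).
Hypothesis N2 : (2 <= N)%N.

Lemma partition_functionE (V : probability (sphere R) R) :
  partition_function c V beta =
  (\int[power_measure V N]_p (\prod_(e in pairs [set: 'I_N]%SET)
     chordal_dist (tnth p e.1) (tnth p e.2) `^ (2 * c e.1 e.2 * beta))%:E)%E.
Proof.
apply: eq_integral => p _; congr EFin.
exact: (prod_pairsT (fun i j => chordal_dist (tnth p i) (tnth p j) `^ (2 * c i j * beta))).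
Qed.

Lemma pair_weight_gt0E (S : {set 'I_N}) : (1 < #|S|)%N ->
  (0 < pair_weight (fun i j => 2 * c i j * beta) S + 2 * #|S|.-1%:R) =
  (-1 < beta * weight_ratio c S).
Proof.
move=> S1; have n0 : 0 < #|S|.-1%:R :> R by rewrite ltr0n; lia.
have nE : #|S|%:R - 1 = #|S|.-1%:R :> R by rewrite -[in LHS](ltn_predK S1) -natr1 addrK.
rewrite /weight_ratio nE sum_pairs; set s := \sum_(e in _) _.
have -> : pair_weight (fun i j => 2 * c i j * beta) S = 2 * (beta * s).
  by rewrite /pair_weight mulrA mulr_sumr; apply: eq_bigr => e _; ring.
rewrite [beta * (_ / _)]mulrA ltr_pdivlMr //; apply/idP/idP; lra.
Qed.

Let mn := \big[Order.min/weight_ratio c [set: 'I_N]%SET]_(S : {set 'I_N} | (2 <= #|S|)%N)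
  weight_ratio c S.
Let mx := \big[Order.max/weight_ratio c [set: 'I_N]%SET]_(S : {set 'I_N} | (2 <= #|S|)%N)
  weight_ratio c S.

Let cardT2 : (2 <= #|[set: 'I_N]%SET|)%N.
Proof. by rewrite cardsT card_ord. Qed.

(** The default value of the minimum is the ratio of the full set, which is in the range as
    [N >= 2]. *)
Let mn_attained : exists2 S : {set 'I_N}, (2 <= #|S|)%N & mn = weight_ratio c S.
Proof.
pose K x := exists2 S : {set 'I_N}, (2 <= #|S|)%N & x = weight_ratio c S.
apply: (big_ind K) => [|x y hx hy|S hS]; [by exists [set: 'I_N]%SET| |by exists S].
by rewrite minEle; case: ifP.
Qed.

Let mx_attained : exists2 S : {set 'I_N}, (2 <= #|S|)%N & mx = weight_ratio c S.
Proof.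
pose K x := exists2 S : {set 'I_N}, (2 <= #|S|)%N & x = weight_ratio c S.
apply: (big_ind K) => [|x y hx hy|S hS]; [by exists [set: 'I_N]%SET| |by exists S].
by rewrite maxEle; case: ifP.
Qed.

(** For [beta >= 0] the product [beta * weight_ratio c S] is smallest at the minimal ratio, for
    [beta < 0] at the maximal one, so only two inequalities matter. Each can fail only if its
    extremal ratio has the sign tested in [beta_plus] or [beta_minus]. *)
Lemma threshold_ratioP : (beta_minus c < beta%:E < beta_plus c)%E <->
  (forall S : {set 'I_N}, (1 < #|S|)%N -> -1 < beta * weight_ratio c S).
Proof.
have mn_le (S : {set 'I_N}) : (2 <= #|S|)%N -> mn <= weight_ratio c S.
  by move=> S2; exact: bigmin_le_cond.
have mx_ge (S : {set 'I_N}) : (2 <= #|S|)%N -> weight_ratio c S <= mx.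
  by move=> S2; exact: le_bigmax_cond.
have mnx : mn <= mx by apply: le_trans (mn_le _ cardT2) (mx_ge _ cardT2).
have plusE : (beta%:E < beta_plus c)%E = ((mn < 0) ==> (-1 < beta * mn)).
  rewrite /beta_plus /Tp -/mn oppr_gt0; case: ifP => [m0|_]; last by rewrite ltry.
  rewrite lte_fin -[X in beta < X]mul1r ltr_pdivlMr ?oppr_gt0 //=.
  by apply/idP/idP; lra.
have minusE : (beta_minus c < beta%:E)%E = ((0 < mx) ==> (-1 < beta * mx)).
  rewrite /beta_minus /Tm -/mx oppr_lt0; case: ifP => [m0|_]; last by rewrite ltNyr.
  by rewrite lte_fin invrN -[- mx^-1]mulN1r ltr_pdivrMr.
rewrite minusE plusE; split=> [/andP[/implyP hx /implyP hn] S S1|h].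
  have h1 := mn_le _ S1; have h2 := mx_ge _ S1.
  have [b0|b0] := lerP 0 beta.
    apply: lt_le_trans (ler_wpM2l b0 h1).
    have [m0|m0] := ltP mn 0; first exact: hn.
    by apply: (@lt_le_trans _ _ 0); [rewrite ltrN10|exact: mulr_ge0].
  apply: lt_le_trans (ler_wnM2l (ltW b0) h2).
  have [m0|m0] := ltP 0 mx; first exact: hx.
  by apply: (@lt_le_trans _ _ 0); [rewrite ltrN10|rewrite nmulr_rge0].
have [S hS ->] := mx_attained; have [S' hS' ->] := mn_attained.
by rewrite !h // !implybT.
Qed.

End Threshold.

Theorem theorem1p3 (R : realType) (V : probability (sphere R) R)
  (hV : rotation_invariant V)
  (N : nat) (hN : (2 <= N)%N) (c : 'I_N -> 'I_N -> R) (beta : R) :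
  (partition_function c V beta < +oo)%E <-> (beta_minus c < beta%:E < beta_plus c)%E.
Proof.
rewrite threshold_ratioP // partition_functionE.
pose a i j := 2 * c i j * beta.
have dist_ge0 := @chordal_ge0 R; have distxx := @chordalxx R.
have dist_sym := @chordal_sym R; have dist_tri := @chordal_tri R.
have dist_le2 := @chordal_le2 R.
(* Both general integral criteria now apply, with the cap constants [64] and [(6 * 11^2)^-1]. *)
have ble := cap_le hV; have bge := cap_ge hV.
split=> [Zoo S S1|h]; last first.
  have ha (S : {set 'I_N}) : (1 < #|S|)%N -> 0 < pair_weight a S + 2 * #|S|.-1%:R.
    by move=> S1; rewrite pair_weight_gt0E // h.
  exact: (integral_prod_dist_lty (@measurable_chordal R) dist_ge0 distxx
    dist_sym dist_tri dist_le2 ble (ltnW hN) ha).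
rewrite -pair_weight_gt0E // ltNge; apply/negP => S0.
have c0 : 0 < (6 * 11 ^+ 2)^-1 :> R by rewrite invr_gt0 mulr_gt0 // exprn_gt0.
have Z := integral_prod_dist_pinfty (@measurable_chordal R) dist_sym dist_tri dist_le2
  ble bge c0 S1 S0.
by move: Zoo; rewrite Z ltxx.
Qed.
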